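(* Let $H$ and $T$ be random variables with laws $\varrho_{\mathcal{H}}$ and $\varrho_{\mathcal{T}^*}$, respectively (the spectral densities of the hexagonal lattice $\mathcal{H}$ and of the triangular lattice with loops $\mathcal{T}^*$). Then their characteristic functions $\varphi_H(s)=\mathbb{E}\,e^{isH}$ and $\varphi_T(s)=\mathbb{E}\,e^{isT}$ satisfy, for all $s\in\mathbb{R}$, $$\varphi_H(s)=\frac{d}{ds}\left[s\int_0^1 I_0^3\left(2is\sqrt{t(1-t)}\right)dt\right],$$ $$\varphi_T(s)=\int_0^1 I_0^3\left(2i\sqrt{is\log t}\right)dt .$$
   Context: The hexagonal lattice $\mathcal{H}$ is the infinite graph with vertex set $V(\mathcal{H})=\{(\sqrt3\,x+\tfrac{\sqrt3}{2}y,\ \tfrac{3}{2}y+c)\in\mathbb{R}^2 : x,y\in\mathbb{Z},\ c\in\{0,1\}\}$, in which every vertex is joined by an edge to its three nearest neighbours in $V(\mathcal{H})$ (Euclidean distance). The triangular lattice $\mathcal{T}$ has vertex set $V(\mathcal{T})=\{v\in V(\mathcal{H}): c=0\}$, in which every vertex is joined by an edge to its six nearest neighbours in $V(\mathcal{T})$. The graph $\mathcal{T}^*$ is obtained from $\mathcal{T}$ by adding three loops at every vertex (equivalently, one loop of weight $3$; each of the three loops counts as a distinct possible step from a vertex to itself). For $\mathcal{L}\in\{\mathcal{H},\mathcal{T}^*\}$, $\mu_k(\mathcal{L})$ denotes the number of closed paths (closed walks; vertices and edges may repeat) of length $k$ on $\mathcal{L}$ starting and ending at a fixed vertex; it does not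 depend on the vertex. The spectral density $\varrho_{\mathcal{L}}$ is the unique compactly supported Borel probability measure on $\mathbb{R}$ with $\int_{\mathbb{R}}x^k\,d\varrho_{\mathcal{L}}(x)=\mu_k(\mathcal{L})$ for all $k\in\mathbb{N}$. $I_0(x)=\sum_{k=0}^\infty\frac{1}{(k!)^2}\left(\frac{x}{2}\right)^{2k}$, $x\in\mathbb{C}$, is the modified Bessel function of the first kind of order $0$, and $I_0^3(x)=(I_0(x))^3$. Since $I_0$ is even, the choice of complex square root is irrelevant. *)

(* Defs.v *)
From HB Require Import structures.
From mathcomp Require Import all_boot all_order all_algebra.
From mathcomp Require Import finmap.
From mathcomp Require Import complex.
From mathcomp Require Import all_classical all_reals all_analysis.
Set Implicit Arguments.
Unset Strict Implicit.
Unset Printing Implicit Defensive.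
Import Order.TTheory GRing.Theory Num.Theory.
Import numFieldNormedType.Exports.
Local Open Scope classical_set_scope.
Local Open Scope ring_scope.
Local Open Scope complex_scope.

(* The norm of the product type R * R is the sup norm, hence an explicit
   Euclidean distance. *)
Definition eucl_dist (R : realType) (u v : R * R) : R :=
  Num.sqrt ((u.1 - v.1) ^+ 2 + (u.2 - v.2) ^+ 2).

(* [v] is one of the [n] points of [V] nearest to [u]: at most [n] points of
   [V] other than [u] are at least as close to [u] as [v] is. *)
Definition n_nearest (R : realType) (V : set (R * R)) (n : nat) (u v : R * R) :=
  [/\ V u, V v, v <> u &
      ([set w | [/\ V w, w <> u & eucl_dist u w <= eucl_dist u v]] #<= `I_n)%card].

(* Edges are undirected: each vertex is joined to its [n] nearest ones. *)
Definition nn_edge (R : realType) (V : set (R * R)) (n : nat) (u v : R * R) :=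
  n_nearest V n u v \/ n_nearest V n v u.

Definition lattice_pt (R : realType) (x y : int) (c : bool) : R * R :=
  (Num.sqrt 3 * x%:~R + Num.sqrt 3 / 2 * y%:~R, 3 / 2 * y%:~R + c%:R).

Definition hex_vertex (R : realType) : set (R * R) :=
  [set v | exists x y c, v = lattice_pt R x y c].

Definition tri_vertex (R : realType) : set (R * R) :=
  [set v | exists x y, v = lattice_pt R x y false].

(* A multigraph on a type [V] is given by the number [m u v] of edges along
   which one can step from [u] to [v]; a loop counts once in [m u u]. *)
Definition hex_mult (R : realType) (u v : R * R) : nat :=
  `[< nn_edge (@hex_vertex R) 3 u v >].

Definition tri_loop_mult (R : realType) (u v : R * R) : nat :=
  (`[< nn_edge (@tri_vertex R) 6 u v >] + 3 * `[< tri_vertex u /\ v = u >])%N.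

(* A walk of length [k] from [v] is the sequence of its [k] steps, each one
   recording the vertex reached and which of the parallel edges is used. *)
Definition closed_walks (V : choiceType) (m : V -> V -> nat) (k : nat) (v : V) :
    set (k.-tuple (V * nat)) :=
  [set p | path (fun a b : V * nat => b.2 < m a.1 b.1)%N (v, 0%N) p /\
           (last (v, 0%N) p).1 = v].

Definition nb_closed_walks (V : choiceType) (m : V -> V -> nat) (k : nat)
    (v : V) : nat :=
  #|` fset_set (@closed_walks V m k v)|%fset.

(* [v] is the base vertex of the closed walks.  By the first clause, all powers
   of [x] are integrable with respect to [rho]. *)
Definition is_spectral_density (R : realType) (V : choiceType)
    (m : V -> V -> nat) (v : V) (rho : probability R R) : Prop :=
  (exists K : set R, compact K /\ rho (~` K) = 0%E) /\
  forall k : nat, (\int[rho]_x (x ^+ k)%:E = (nb_closed_walks m k v)%:R%:E)%E.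

Definition cexp (R : realType) (z : R[i]) : R[i] :=
  (expR (complex.Re z))%:C * (cos (complex.Im z) +i* sin (complex.Im z)).

(* The topology of R[i] is the one of its regular module R[i]^o. *)
Definition besselI0 (R : realType) (z : R[i]) : R[i] :=
  limn (series (fun k : nat =>
    ((k`!%:R ^+ 2)^-1 * (z / 2) ^+ (2 * k) : R[i]^o))).

Section complex_integral.
Context (d : measure_display) (T : measurableType d) (R : realType).
Implicit Types (mu : {measure set T -> \bar R}) (D : set T) (f : T -> R[i]).

Definition cintegrable mu D f : Prop :=
  mu.-integrable D (fun x => (complex.Re (f x))%:E) /\
  mu.-integrable D (fun x => (complex.Im (f x))%:E).

Definition cintegral mu D f : R[i] :=
  Rintegral mu D (fun x => complex.Re (f x)) +i*
  Rintegral mu D (fun x => complex.Im (f x)).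

End complex_integral.

Definition char_fun (d : measure_display) (T : measurableType d) (R : realType)
    (P : probability T R) (X : {RV P >-> R}) (s : R) : R[i] :=
  cintegral P setT (fun w => cexp ('i * s%:C * (X w)%:C)).

Definition has_cderivative (R : realType) (f : R -> R[i]) (s : R) (l : R[i]) :=
  (fun h : R => (h%:C)^-1 * (f (s + h) - f s) : R[i]^o) @ 0^' --> (l : R[i]^o).

(* The following two functions of [t] are meant on ]0, 1[ only; the library has
   [ln 0 = 0]. *)
Definition hex_integrand (R : realType) (s t : R) : R[i] :=
  besselI0 (2 * 'i * s%:C * (Num.sqrt (t * (1 - t)))%:C) ^+ 3.

Definition tri_integrand (R : realType) (s t : R) : R[i] :=
  besselI0 (2 * 'i * sqrtC ('i * s%:C * (ln t)%:C)) ^+ 3.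

(* Main.v *)
Require Import Defs.
From HB Require Import structures.
From mathcomp Require Import all_boot all_order all_algebra.
From mathcomp Require Import finmap complex zify ring lra.
From mathcomp Require Import all_classical all_reals all_analysis.
From mathcomp Require Import measurable_realfun.
Import Order.TTheory GRing.Theory Num.Theory.
Import numFieldNormedType.Exports.
Local Open Scope classical_set_scope.
Local Open Scope ring_scope.
Local Open Scope complex_scope.
Set Implicit Arguments.
Unset Strict Implicit.
Unset Printing Implicit Defensive.

(* Two successive steps on the hexagonal lattice are one step on the triangular
   lattice with loops, so the number [a_n] of closed walks is the same for [n]
   triangular and [2 n] hexagonal steps; for an odd number of hexagonal steps it
   is [0].  A closed walk amounts to a pair of words of length [n] over three
   letters with equal letter counts, so [a_n] is the sum of the squared trinomial
   coefficients of order [n], and [I_0(2 sqrt z) ^ 3] is the power series with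
   coefficients [a_n / n!^2].  Since the integrals over ]0, 1[ of [(- log t) ^ n]
   and [(t (1 - t)) ^ n] are [n!] and [n!^2 / (2 n + 1)!], integrating this series
   termwise gives [sum_n a_n (i s) ^ n / n!] for the triangular lattice and
   [sum_n a_n (i s) ^ 2n / (2 n + 1)!] for the hexagonal one.  The former is the
   series of the characteristic function, the latter becomes it after
   multiplication by [s] and differentiation. *)

(** * Closed walks and trinomial coefficients *)

Section trinomial.
Local Open Scope nat_scope.

(** The product of the two binomials is the trinomial coefficient: [s] letters of a word over {0, 1,
    2} are nonzero, and [i] of these are 1. Hence this sums [F], taken at the numbers of letters 1
    and 2, over all words of length [n]. *)
Definition trinomial_sum (n : nat) (F : nat -> nat -> nat) : nat :=
  \sum_(s < n.+1) 'C(n, s) * \sum_(i < s.+1) 'C(s, i) * F i (s - i).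

Definition sq_trinomial_sum (n : nat) : nat :=
  \sum_(s < n.+1) 'C(n, s) ^ 2 * \sum_(i < s.+1) 'C(s, i) ^ 2.

Lemma sum_binS (n : nat) (h : nat -> nat) :
  \sum_(s < n.+2) 'C(n.+1, s) * h s =
  \sum_(s < n.+1) 'C(n, s) * (h s + h s.+1).
Proof.
rewrite big_ord_recl bin0 mul1n.
under eq_bigr => i _ do rewrite lift0 binS mulnDl.
rewrite big_split /= addnA.
under [RHS]eq_bigr => i _ do rewrite mulnDr.
rewrite [RHS]big_split /=; congr (_ + _).
rewrite [RHS]big_ord_recl bin0 mul1n; congr (_ + _).
by rewrite big_ord_recr /= bin_small // addn0.
Qed.

Lemma eq_trinomial_sum (n : nat) (F G : nat -> nat -> nat) :
  (forall i j, F i j = G i j) -> trinomial_sum n F = trinomial_sum n G.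
Proof.
move=> FG; apply: eq_bigr => s _; congr (_ * _).
by apply: eq_bigr => i _; rewrite FG.
Qed.

Lemma trinomial_sum_sum (I : finType) (n : nat) (F : I -> nat -> nat -> nat) :
  trinomial_sum n (fun i j => \sum_(a : I) F a i j) =
  \sum_(a : I) trinomial_sum n (F a).
Proof.
rewrite exchange_big; apply: eq_bigr => s _ /=.
rewrite -big_distrr /= exchange_big /=; congr (_ * _).
by apply: eq_bigr => i _; rewrite big_distrr.
Qed.

(** One letter [a] is split off the word; only the letters 1 and 2 change the counts. Pascal's rule
    is used once for [s] and once for [i]. *)
Lemma trinomial_sumS (n : nat) (F : nat -> nat -> nat) :
  trinomial_sum n.+1 F = \sum_(a < 3)
    trinomial_sum n (fun i j => F (i + (a == 1 :> nat)) (j + (a == 2 :> nat))).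
Proof.
rewrite -trinomial_sum_sum.
under [RHS]eq_trinomial_sum => i j.
  by rewrite !big_ord_recl big_ord0 /= !addn0 !addn1; over.
rewrite /trinomial_sum.
rewrite (sum_binS n (fun s => \sum_(i < s.+1) 'C(s, i) * F i (s - i))).
apply: eq_bigr => s _; congr (_ * _).
rewrite (sum_binS s (fun i => F i (s.+1 - i))) -big_split /=.
apply: eq_bigr => i _; rewrite -mulnDr subSS subSn ?leq_ord //.
by rewrite (addnC (F i (_.+1))).
Qed.

(** In the inner double sum the indicator leaves one term, the one with the outer indices, so each
    trinomial coefficient meets itself. The left side counts the pairs of words with equal letter
    counts. *)
Lemma trinomial_sum_diag (n : nat) :
  trinomial_sum n (fun i j => trinomial_sum n (fun i' j' =>
    (i == i') && (j == j') : nat)) = sq_trinomial_sum n.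
Proof.
apply: eq_bigr => s _; rewrite -mulnn -mulnA; congr (_ * _).
rewrite big_distrr /=; apply: eq_bigr => i _.
rewrite /trinomial_sum (bigD1 s) //= (bigD1 i) //= !eqxx muln1.
rewrite big1 => [|j ji]; last first.
  by rewrite (_ : (_ == _) = false) ?muln0//; move: ji; rewrite -val_eqE /=; lia.
rewrite big1 => [|s' ss']; last first.
  rewrite big1 ?muln0 // => j _.
  rewrite (_ : _ && _ = false) ?muln0 //.
  have := ltn_ord i; have := ltn_ord j; move: ss'; rewrite -val_eqE /=; lia.
by rewrite !addn0 mulnCA mulnn.
Qed.

Lemma trinomial_sum1 (n : nat) : trinomial_sum n (fun _ _ => 1) = 3 ^ n.
Proof.
rewrite /trinomial_sum -[3]/(1 + 2) expnDn; apply: eq_bigr => s _.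
rewrite exp1n mul1n; congr (_ * _).
rewrite -[2]/(1 + 1) expnDn; apply: eq_bigr => i _.
by rewrite !exp1n !muln1.
Qed.

(** There are [9 ^ n] pairs of words in all; the indicator of equal counts is bounded by 1. *)
Lemma sq_trinomial_sum_le (n : nat) : sq_trinomial_sum n <= 9 ^ n.
Proof.
rewrite -[9]/(3 * 3) expnMn -{1}trinomial_sum1 /trinomial_sum.
rewrite big_distrl /= -trinomial_sum_diag; apply: leq_sum => s _.
rewrite -mulnA leq_mul2l; apply/orP; right.
rewrite big_distrl /=; apply: leq_sum => i _.
rewrite muln1 leq_mul2l; apply/orP; right.
rewrite -trinomial_sum1; apply: leq_sum => s' _.
rewrite leq_mul2l; apply/orP; right.
by apply: leq_sum => i' _; rewrite leq_mul2l leq_b1 orbT.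
Qed.

End trinomial.

(* The neighbours of a vertex of the sublattice [c = false] differ from it by one
   of three vectors, here in the coordinates [(x, y)]: (0, 0), (0, -1), (1, -1). *)
Definition hex_shift (a : 'I_3) : int * int :=
  ((a == 2 :> nat)%:Z, - ((a == 1 :> nat) + (a == 2 :> nat))%N%:Z).

(* The step coded by [a] is the hexagonal step [a.1] followed by the reverse of the
   step [a.2]; the three loops are the pairs with [a.1 = a.2]. *)
Definition tri_step (p : int * int) (a : 'I_3 * 'I_3) : int * int :=
  p + (hex_shift a.1 - hex_shift a.2).

(** The vectors added on one sublattice are subtracted on the other, so the same letter taken twice
    leads back. *)
Definition hex_step (p : int * int * bool) (i : 'I_3) : int * int * bool :=
  (if p.2 then p.1 - hex_shift i else p.1 + hex_shift i, ~~ p.2).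

Section words.
Variables (S : finType) (X : eqType) (step : X -> S -> X).

Fixpoint nb_words (n : nat) (p q : X) : nat :=
  if n is n'.+1 then (\sum_(s : S) nb_words n' (step p s) q)%N else (p == q).

End words.

(** A word over pairs is a pair of words, and its displacement depends on their letter counts only:
    [i] letters 1 and [j] letters 2 contribute [(j, - (i + j))], with the opposite sign in the
    second word. *)
Lemma nb_words_tri (n : nat) (p q : int * int) :
  nb_words tri_step n p q =
  trinomial_sum n (fun i j => trinomial_sum n (fun i' j' =>
    p + (j%:Z - j'%:Z, (i' + j')%N%:Z - (i + j)%N%:Z) == q : nat)).
Proof.
elim: n p => [|n IH] p.
  by rewrite /trinomial_sum !(big_ord1, bin0, mul1n) /= !subrr addr0.
rewrite /= trinomial_sumS.
under eq_bigr => a _ do rewrite IH.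
rewrite -(pair_bigA _ (fun a b => trinomial_sum n (fun i j =>
  trinomial_sum n (fun i' j' => p + (hex_shift a - hex_shift b) +
    (j%:Z - j'%:Z, (i' + j')%N%:Z - (i + j)%N%:Z) == q : nat)))) /=.
apply: eq_bigr => a _; rewrite -trinomial_sum_sum.
apply: eq_trinomial_sum => i j; rewrite trinomial_sumS.
apply: eq_bigr => b _; apply: eq_trinomial_sum => i' j'.
congr (nat_of_bool (_ == q)); rewrite -addrA; congr (p + _).
by congr pair; rewrite /= !PoszD; ring.
Qed.

Lemma nb_words_tri_closed (n : nat) (p : int * int) :
  nb_words tri_step n p p = sq_trinomial_sum n.
Proof.
rewrite nb_words_tri -trinomial_sum_diag.
apply: eq_trinomial_sum => i j; apply: eq_trinomial_sum => i' j'.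
congr nat_of_bool; rewrite -subr_eq0 addrAC subrr add0r xpair_eqE.
lia.
Qed.

(** Every step changes the sublattice; the hypothesis says that [n] has the wrong parity for joining
    [p] to [q]. *)
Lemma nb_words_hex_odd (n : nat) (p q : int * int * bool) :
  odd n = (p.2 == q.2) -> nb_words hex_step n p q = 0%N.
Proof.
elim: n p => [|n IH] p /=.
  by case: p q => [p c] [q d] /= /esym/negbT cd; rewrite xpair_eqE (negPf cd) andbF.
move=> pq; rewrite big1 // => a _; apply: IH => /=.
by case: p.2 q.2 (odd n) pq => [] [] [].
Qed.

Lemma nb_words_hex_even (n : nat) (p q : int * int) (c : bool) :
  nb_words hex_step n.*2 (p, c) (q, c) = nb_words tri_step n p q.
Proof.
elim: n p => [|n IH] p /=; first by rewrite xpair_eqE eqxx andbT.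
rewrite -(pair_bigA _ (fun a b => nb_words tri_step n (tri_step p (a, b)) q)) /=.
case: c IH => IH.
  (* From the sublattice [true] the first step is the subtracted one, so the two letters enter
     [tri_step] in the opposite order. *)
  rewrite exchange_big /=; apply: eq_bigr => b _; apply: eq_bigr => a _.
  rewrite (_ : hex_step _ _ = (tri_step p (b, a), true)) ?IH //.
  by rewrite /hex_step /tri_step /= -addrA (addrC (- _)).
apply: eq_bigr => b _; apply: eq_bigr => a _.
rewrite (_ : hex_step _ _ = (tri_step p (b, a), false)) ?IH //.
by rewrite /hex_step /tri_step /= addrA.
Qed.

(** * Geometry of the two lattices *)

Section walks.
Variables (V : choiceType) (m : V -> V -> nat).
Variables (S : finType) (X : choiceType).
Variables (step : X -> S -> X) (lab : X -> S -> nat) (emb : X -> V).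
Hypothesis emb_inj : injective emb.
Hypothesis step_inj : forall p, injective (fun a => (step p a, lab p a)).
Hypothesis stepP : forall p v l,
  (l < m (emb p) v)%N <-> exists a, v = emb (step p a) /\ l = lab p a.

(** A letter is read as the vertex it leads to together with the parallel edge it uses. [step_inj]
    makes this reading faithful, and [stepP] makes it reach every walk. *)
Fixpoint coded_walks (n : nat) (p : X) : seq (seq (V * nat)) :=
  if n is n'.+1 then
    [seq (emb (step p a), lab p a) :: w
    | a <- enum S, w <- coded_walks n' (step p a)]
  else [:: [::]].

Lemma coded_walks_uniq (n : nat) (p : X) : uniq (coded_walks n p).
Proof.
elim: n p => //= n IH p; apply: allpairs_uniq_dep => [|a _|]; rewrite ?enum_uniq //.
move=> [a w] [b w'] _ _ /= [] /emb_inj ab lab' ww'.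
have eab : a = b by apply: (step_inj (p := p)); rewrite ab lab'.
by subst b; rewrite ww'.
Qed.

(** The edge label [l] of the start is never read; it is arbitrary so that the induction can resume
    after the first step. *)
Lemma mem_coded_walks (n l : nat) (p : X) (w : seq (V * nat)) :
  (w \in coded_walks n p) = (size w == n) &&
    path (fun a b : V * nat => b.2 < m a.1 b.1)%N (emb p, l) w.
Proof.
elim: n l p w => [|n IH] l p [|[v k] w] //=.
  by apply/negbTE/allpairsPdep => -[a [w' []]].
apply/allpairsPdep/idP => [[a [w' [_ + [-> -> ->]]]]|].
  rewrite (IH (lab p a)) => /andP[/eqP -> ->]; rewrite eqxx /= andbT.
  by apply/stepP; exists a.
rewrite eqSS => /and3P[/eqP sw /stepP[a [-> ->]] pw].
by exists a, w; rewrite mem_enum (IH (lab p a)) sw eqxx.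
Qed.

Lemma count_coded_walks (n l : nat) (p q : X) :
  count (fun w => (last (emb p, l) w).1 == emb q) (coded_walks n p) =
  nb_words step n p q.
Proof.
elim: n l p => [|n IH] l p /=; first by rewrite (inj_eq emb_inj) addn0.
rewrite count_flatten -map_comp sumnE big_map big_enum /=.
apply: eq_bigr => a _; rewrite count_map -(IH (lab p a)).
by apply: eq_count => w.
Qed.

Lemma nb_closed_walks_words (n : nat) (p : X) :
  nb_closed_walks m n (emb p) = nb_words step n p p.
Proof.
pose s := [seq w <- coded_walks n p | (last (emb p, 0%N) w).1 == emb p].
(* All sequences in [s] have length [n], so [insub] discards none. *)
pose t : seq (n.-tuple (V * nat)) := pmap insub s.
have us : uniq s by rewrite filter_uniq ?coded_walks_uniq.
have sz w : w \in s -> size w == n.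
  by rewrite mem_filter (mem_coded_walks _ 0) => /and3P[].
rewrite /nb_closed_walks -(count_coded_walks n 0) -size_filter -/s.
have -> : closed_walks m (k := n) (emb p) = [set` [fset w in t]%fset].
  apply/seteqP; split => w /=; rewrite inE /= mem_pmap_sub mem_filter.
    by move=> [pw ew]; rewrite (mem_coded_walks _ 0) pw size_tuple eqxx ew eqxx.
  by rewrite (mem_coded_walks _ 0) => /and3P[/eqP ? _ ?].
rewrite set_fsetK card_fseq undup_id ?pmap_sub_uniq // size_pmap_sub.
by apply/eqP; rewrite -all_count; apply/allP.
Qed.

End walks.

(** The points at least as close as a member of [N] all lie in [N], hence are at most [n]. For any
    other point [v], the members of [v :: N] are [n + 1] points at least as close as [v], one too
    many. *)
Lemma n_nearestP (R : realType) (A : set (R * R)) (n : nat) (u : R * R)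
    (N : seq (R * R)) (r : R) (v : R * R) :
  A u -> size N = n -> uniq N ->
  (forall w, w \in N -> [/\ A w, w <> u & eucl_dist u w = r]) ->
  (forall w, A w -> w <> u -> w \notin N -> r < eucl_dist u w) ->
  n_nearest A n u v <-> v \in N.
Proof.
move=> Au sN uN NP farP.
have cardN (s : seq (R * R)) :
    uniq s -> ([set` [fset w in s]%fset] #= `I_(size s))%card.
  by move=> us; apply/card_eq_fsetP; rewrite card_fseq undup_id.
split=> [[_ Av vu le_n]|vN]; last first.
  have [Av vu dv] := NP _ vN; split => //.
  rewrite dv -sN -(card_le_eqr (cardN _ uN)).
  apply/subset_card_le => w [Aw wu wr] /=; rewrite inE /=.
  by apply: contraTT wr => /(farP _ Aw wu); rewrite ltNge.
apply: contrapT => /negP vN.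
suff : (`I_(size (v :: N)) #<= `I_n)%card by rewrite card_le_II /= sN ltnn.
have uvN : uniq (v :: N) by rewrite /= vN.
apply: card_le_trans le_n; rewrite -(card_le_eql (cardN _ uvN)).
apply/subset_card_le => w /=; rewrite !inE => /predU1P[-> //|wN].
by have [Aw wu ->] := NP _ wN; split => //; apply/ltW/farP.
Qed.

Section lattices.
Variable R : realType.

Definition hex_pt (p : int * int * bool) : R * R := lattice_pt R p.1.1 p.1.2 p.2.

Definition tri_pt (p : int * int) : R * R := hex_pt (p, false).

(** The squared Euclidean distance: the square roots of 3 disappear, so distances are compared by
    integer arithmetic. *)
Definition sq_dist (p q : int * int * bool) : int :=
  let a := p.1.1 - q.1.1 in let b := p.1.2 - q.1.2 in let e := p.2%:Z - q.2%:Z in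
  3 * (a * a + a * b + b * b + b * e) + e * e.

Lemma eucl_dist_hex_pt (p q : int * int * bool) :
  eucl_dist (hex_pt p) (hex_pt q) = Num.sqrt (sq_dist p q)%:~R.
Proof.
case: p q => [[x y] c] [[x' y'] c']; rewrite /eucl_dist /sq_dist /=.
congr Num.sqrt; set s : R := Num.sqrt 3.
have ss : s * s = 3 by rewrite -expr2 sqr_sqrtr.
rewrite !(rmorphD, rmorphM, rmorphB) /= -!pmulrn.
by field: ss.
Qed.

Lemma hex_pt_inj : injective hex_pt.
Proof.
move=> [[x y] c] [[x' y'] c'] [] /= h1 h2.
(* This is twice the ordinate; its residue modulo 3 determines [c]. *)
have e2 : (3 * y + 2 * c%:Z = 3 * y' + 2 * c'%:Z).
  apply/eqP; rewrite -(eqr_int R) !rmorphD !rmorphM /= -!pmulrn; apply/eqP.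
  by lra.
have [yy cc] : y = y' /\ c = c' by case: c c' e2 {h2} => [] []; lia.
subst y' c'; congr (_, _, _); apply/eqP; rewrite -(eqr_int R).
by move: h1 => /addIr /mulfI -> //.
Qed.

Lemma tri_pt_inj : injective tri_pt.
Proof. by move=> p q /hex_pt_inj []. Qed.

Lemma hex_vertexP (v : R * R) : hex_vertex v <-> exists p, v = hex_pt p.
Proof.
split=> [[x [y [c ->]]]|[[[x y] c] ->]]; first by exists (x, y, c).
by exists x, y, c.
Qed.

Lemma tri_vertexP (v : R * R) : tri_vertex v <-> exists p, v = tri_pt p.
Proof.
split=> [[x [y ->]]|[[x y] ->]]; first by exists (x, y).
by exists x, y.
Qed.

Lemma hex_step_inj (p : int * int * bool) : injective (hex_step p).
Proof.
case: p => -[x y] c a b [h]; apply: val_inj => /=; have := ltn_ord a.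
have := ltn_ord b; case: c h => /= -[]; lia.
Qed.

Lemma sq_dist_hex_step (p : int * int * bool) (a : 'I_3) :
  sq_dist p (hex_step p a) = 1 /\ hex_step p a <> p.
Proof.
case: p => -[x y] c; split; last by case; case: c.
by case: a => -[|[|[|//]]] ?; rewrite /sq_dist /hex_shift /=; case: c => /=; lia.
Qed.

(** Within a sublattice the squared distance is a multiple of 3, so the bound forces equality of the
    points. Between the sublattices it becomes the inequality of [small], up to the sign of the
    coordinates. *)
Lemma hex_step_of_sq_dist (p q : int * int * bool) :
  q <> p -> sq_dist p q <= 1 -> exists a, q = hex_step p a.
Proof.
have small (a b : int) : a * a + a * b + b * b + b <= 0 ->
    [\/ a = 0 /\ b = 0, a = 0 /\ b = -1 | a = 1 /\ b = -1].
  move=> h.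
  (* Four times the left side of [h] is [(2 a + b) ^ 2 + b (3 b + 4)]. *)
  have hb : b * (3 * b + 4) <= 0.
    have : 0 <= (2 * a + b) * (2 * a + b) by rewrite -expr2 sqr_ge0.
    by lia.
  have [bE|bE] : b = 0 \/ b = -1 by nia.
    by subst b; apply: Or31; split => //; nia.
  have [aE|aE] : a = 0 \/ a = 1 by nia.
    exact: Or32.
  exact: Or33.
case: p q => [[x y] c] [[x' y'] c']; rewrite /sq_dist /= => qp h.
have [cc|cc] := eqVneq c c'.
  subst c'; exfalso; apply: qp.
  suff [-> ->] : x' = x /\ y' = y by [].
  set a := x - x' in h; set b := y - y' in h.
  have : 0 <= (2 * a + b) * (2 * a + b) by rewrite -expr2 sqr_ge0.
  move=> sq_ge0; have b0 : b = 0 by nia.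
  have a0 : a = 0 by move: h; rewrite b0; nia.
  by move: a0 b0; rewrite /a /b; lia.
have {cc} cE : c' = ~~ c by case: c c' cc {h qp} => [] [].
subst c'; case: c h {qp} => /= h.
  have {}h : (x - x') * (x - x') + (x - x') * (y - y') + (y - y') * (y - y') +
     (y - y') <= 0 by lia.
  have [[a b]|[a b]|[a b]] := small _ _ h.
  - by exists ord0; congr (_, _, _); rewrite /=; lia.
  - by exists (inord 1); rewrite /hex_step /hex_shift /= inordK //;
      congr (_, _, _); rewrite /=; lia.
  - by exists (inord 2); rewrite /hex_step /hex_shift /= inordK //;
      congr (_, _, _); rewrite /=; lia.
have {}h : (x' - x) * (x' - x) + (x' - x) * (y' - y) + (y' - y) * (y' - y) +
     (y' - y) <= 0 by lia.
have [[a b]|[a b]|[a b]] := small _ _ h.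
- by exists ord0; congr (_, _, _); rewrite /=; lia.
- by exists (inord 1); rewrite /hex_step /hex_shift /= inordK //;
      congr (_, _, _); rewrite /=; lia.
- by exists (inord 2); rewrite /hex_step /hex_shift /= inordK //;
      congr (_, _, _); rewrite /=; lia.
Qed.

Lemma hex_nearestP (p : int * int * bool) (v : R * R) :
  n_nearest (@hex_vertex R) 3 (hex_pt p) v <-> exists a, v = hex_pt (hex_step p a).
Proof.
rewrite (n_nearestP (N := [seq hex_pt (hex_step p a) | a <- enum 'I_3]) (r := 1)).
- split=> [/mapP[a _ ->]|[a ->]]; first by exists a.
  by apply: map_f; rewrite mem_enum.
- by apply/hex_vertexP; exists p.
- by rewrite size_map size_enum_ord.
- by rewrite map_inj_uniq ?enum_uniq // => a b /hex_pt_inj /hex_step_inj.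
- move=> w /mapP[a _ ->]; have [d1 ap] := sq_dist_hex_step p a; split.
  + by apply/hex_vertexP; exists (hex_step p a).
  + by move/hex_pt_inj.
  + by rewrite eucl_dist_hex_pt d1 sqrtr1.
move=> w /hex_vertexP[q ->] qp qN; rewrite eucl_dist_hex_pt.
suff lt1 : 1 < (sq_dist p q)%:~R :> R.
  by rewrite -[ltLHS]sqrtr1 ltr_sqrt // (lt_trans _ lt1).
rewrite (ltr_int R 1) ltNge; apply: contraNN qN => /hex_step_of_sq_dist [|a ->].
  by move=> e; apply: qp; rewrite e.
by apply: map_f; rewrite mem_enum.
Qed.


(** The same letter undoes the step. This serves the second disjunct of [nn_edge], where the roles
    of the two vertices are exchanged. *)
Lemma hex_step_sym (p q : int * int * bool) :
  (exists a, q = hex_step p a) <-> (exists a, p = hex_step q a).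
Proof.
have half p' q' : (exists a, q' = hex_step p' a) -> exists a, p' = hex_step q' a.
  move=> [a ->]; exists a; case: p' => p' [] /=; rewrite /hex_step /=.
    by rewrite subrK.
  by rewrite addrK.
by split; apply: half.
Qed.

Lemma hex_mult_step (p : int * int * bool) (v : R * R) (l : nat) :
  (l < @hex_mult R (hex_pt p) v)%N <->
  exists a, v = hex_pt (hex_step p a) /\ l = 0%N.
Proof.
have -> : hex_mult (hex_pt p) v = `[< exists a, v = hex_pt (hex_step p a) >] :> nat.
  congr nat_of_bool; apply: asbool_equiv_eq; rewrite /nn_edge.
  split=> [[/hex_nearestP //|nv]|]; last by move=> h; left; apply/hex_nearestP.
  have [/hex_vertexP[q vq] _ _ _] := nv.
  move: nv; rewrite vq => /hex_nearestP[a /hex_pt_inj pq].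
  have /hex_step_sym[b ->] : exists b, p = hex_step q b by exists a.
  by exists b.
case: asboolP => [[a ->]|nex]; last by split=> // -[a [va _]]; case: nex; exists a.
split=> [|[b [_ ->]]] //.
by rewrite ltnS leqn0 => /eqP ->; exists a.
Qed.

Lemma nb_closed_walks_hex (n : nat) (v : R * R) : hex_vertex v ->
  nb_closed_walks (@hex_mult R) n v =
  if odd n then 0%N else sq_trinomial_sum n./2.
Proof.
move=> /hex_vertexP[[p c] ->].
rewrite (nb_closed_walks_words (lab := fun _ _ => 0%N) hex_pt_inj _ hex_mult_step).
  case: ifPn => [on|/negbTE en]; first by rewrite nb_words_hex_odd ?on ?eqxx.
  rewrite -[in LHS](odd_double_half n) en add0n nb_words_hex_even.
  exact: nb_words_tri_closed.
by move=> q a b /(congr1 fst) /hex_step_inj.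
Qed.

(** Pairs of distinct letters code the six simple edges, with label 0. Pairs of equal letters code
    the three loops, told apart by the repeated letter. *)
Definition tri_label (p : int * int) (a : 'I_3 * 'I_3) : nat :=
  if a.1 == a.2 then a.1 : nat else 0.

Lemma tri_step_inj (p : int * int) :
  injective (fun a => (tri_step p a, tri_label p a)).
Proof.
case: p => x y [a b] [a' b']; rewrite /tri_step /tri_label /hex_shift /=.
move=> [h1 h2 h3].
move: h1 h2 h3 => /addrI/eqP + /addrI/eqP + /eqP.
by case: a => -[|[|[|//]]] ?; case: b => -[|[|[|//]]] ?;
  case: a' => -[|[|[|//]]] ?; case: b' => -[|[|[|//]]] ? // _ _ _;
  congr pair; apply: val_inj.
Qed.

Lemma tri_step_neq (p : int * int) (a : 'I_3 * 'I_3) :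
  (tri_step p a == p) = (a.1 == a.2).
Proof.
rewrite -subr_eq0 addrAC subrr add0r.
by case: a => -[[|[|[|//]]] ?] [[|[|[|//]]] ?].
Qed.

Lemma sq_dist_tri_step (p : int * int) (a : 'I_3 * 'I_3) : a.1 != a.2 ->
  sq_dist (p, false) (tri_step p a, false) = 3.
Proof.
case: a p => a b [x y]; rewrite -val_eqE /sq_dist /hex_shift /=.
case: a => -[|[|[|//]]] ? /=; case: b => -[|[|[|//]]] ? //= _; lia.
Qed.

(** The bound reads [a ^ 2 + a b + b ^ 2 <= 1], whence [3 b ^ 2 <= 4]. Besides zero this leaves six
    vectors, each the difference of two distinct hexagonal shifts. *)
Lemma tri_step_of_sq_dist (p q : int * int) :
  q <> p -> sq_dist (p, false) (q, false) <= 3 ->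
  exists2 a, a.1 != a.2 & q = tri_step p a.
Proof.
case: p q => x y [x' y'] qp; rewrite /sq_dist /=.
have step (i j : nat) : (i < 3)%N -> (j < 3)%N -> i != j ->
    x' = x + ((i == 2)%N%:Z - (j == 2)%N%:Z) ->
    y' = y - ((i != 0)%N%:Z - (j != 0)%N%:Z) ->
    exists2 a : 'I_3 * 'I_3, a.1 != a.2 & (x', y') = tri_step (x, y) a.
  move=> i3 j3 ij xE yE; exists (Ordinal i3, Ordinal j3); first by rewrite -val_eqE.
  by rewrite /tri_step /hex_shift /= xE yE; congr pair; rewrite /=; lia.
set a := x - x'; set b := y - y' => h.
have : 0 <= (2 * a + b) * (2 * a + b) by rewrite -expr2 sqr_ge0.
move=> sq_ge0.
have [bE|[bE|bE]] : b = 0 \/ b = 1 \/ b = -1 by nia.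
- have [aE|[aE|aE]] : a = 0 \/ a = 1 \/ a = -1 by move: h; rewrite bE; nia.
  + by exfalso; apply: qp; congr pair; move: aE bE; rewrite /a /b; lia.
  + by apply: (step 1%N 2%N) => //; move: aE bE; rewrite /a /b; lia.
  + by apply: (step 2%N 1%N) => //; move: aE bE; rewrite /a /b; lia.
- have [aE|aE] : a = 0 \/ a = -1 by move: h; rewrite bE; nia.
  + by apply: (step 1%N 0%N) => //; move: aE bE; rewrite /a /b; lia.
  + by apply: (step 2%N 0%N) => //; move: aE bE; rewrite /a /b; lia.
have [aE|aE] : a = 0 \/ a = 1 by move: h; rewrite bE; nia.
- by apply: (step 0%N 1%N) => //; move: aE bE; rewrite /a /b; lia.
- by apply: (step 0%N 2%N) => //; move: aE bE; rewrite /a /b; lia.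
Qed.

Lemma tri_nearestP (p : int * int) (v : R * R) :
  n_nearest (@tri_vertex R) 6 (tri_pt p) v <->
  exists2 a, a.1 != a.2 & v = tri_pt (tri_step p a).
Proof.
pose N := [seq a <- enum {: 'I_3 * 'I_3} | a.1 != a.2].
have inN a : (a \in N) = (a.1 != a.2) by rewrite mem_filter mem_enum andbT.
have uN : uniq N by rewrite filter_uniq // enum_uniq.
have sN : size N = 6%N.
  rewrite -sum1_size big_filter big_enum_cond /=.
  rewrite -(pair_big_dep xpredT (fun i j => i != j) (fun _ _ => 1%N)) /=.
  rewrite (eq_bigr (fun=> 2%N)) => [|i _]; first by rewrite sum_nat_const card_ord.
  rewrite sum1_card; transitivity #|predC1 i|; last by rewrite cardC1 card_ord.
  by apply: eq_card => j; rewrite !inE eq_sym.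
rewrite (n_nearestP (N := [seq tri_pt (tri_step p a) | a <- N]) (r := Num.sqrt 3)).
- split=> [/mapP[a + ->]|[a ane ->]]; first by rewrite inN; exists a.
  by apply: map_f; rewrite inN.
- by apply/tri_vertexP; exists p.
- by rewrite size_map sN.
- rewrite map_inj_in_uniq // => a b; rewrite !inN => /negPf ane /negPf bne.
  move=> /tri_pt_inj ab; apply: (@tri_step_inj p).
  by rewrite ab /tri_label ane bne.
- move=> w /mapP[a + ->]; rewrite inN => ane; split.
  + by apply/tri_vertexP; exists (tri_step p a).
  + by move=> /tri_pt_inj /eqP; rewrite tri_step_neq (negPf ane).
  + by rewrite eucl_dist_hex_pt sq_dist_tri_step.
move=> w /tri_vertexP[q ->] qp qN; rewrite eucl_dist_hex_pt.
suff lt3 : 3 < (sq_dist (p, false) (q, false))%:~R :> R.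
  by rewrite ltr_sqrt // (lt_trans _ lt3).
rewrite (ltr_int R 3) ltNge; apply: contraNN qN => /tri_step_of_sq_dist [|a ane ->].
  by move=> e; apply: qp; rewrite e.
by apply: map_f; rewrite inN.
Qed.

Lemma tri_loop_mult_step (p : int * int) (v : R * R) (l : nat) :
  (l < @tri_loop_mult R (tri_pt p) v)%N <->
  exists a, v = tri_pt (tri_step p a) /\ l = tri_label p a.
Proof.
rewrite /tri_loop_mult.
have -> : `[< nn_edge (@tri_vertex R) 6 (tri_pt p) v >] =
    `[< exists2 a, a.1 != a.2 & v = tri_pt (tri_step p a) >].
  apply: asbool_equiv_eq; rewrite /nn_edge.
  split=> [[/tri_nearestP //|nv]|]; last by move=> h; left; apply/tri_nearestP.
  have [/tri_vertexP[q vq] _ _ _] := nv.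
  move: nv; rewrite vq => /tri_nearestP[a ane /tri_pt_inj pq].
  (* Swapping the two letters reverses the step. *)
  exists (a.2, a.1); first by rewrite eq_sym.
  rewrite pq /tri_step /=.
  by rewrite -(opprB (hex_shift a.1)) addrK.
have -> : `[< tri_vertex (tri_pt p) /\ v = tri_pt p >] = `[< v = tri_pt p >].
  apply: asbool_equiv_eq; split=> [[]|->] //; split=> //.
  by apply/tri_vertexP; exists p.
have loop a : a.1 == a.2 -> tri_step p a = p by rewrite -(tri_step_neq p) => /eqP.
case: asboolP => [[a ane ->]|nedge].
  have -> : `[< tri_pt (tri_step p a) = tri_pt p >] = false.
    by apply/asboolPn => /tri_pt_inj/eqP; rewrite tri_step_neq (negPf ane).
  rewrite addn0 ltnS leqn0; split=> [/eqP ->|[b [/tri_pt_inj ab ->]]].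
    by exists a; rewrite /tri_label (negPf ane).
  by rewrite /tri_label -(tri_step_neq p) -ab tri_step_neq (negPf ane).
have loops a : v = tri_pt (tri_step p a) -> a.1 == a.2.
  by move=> va; apply: contra_notT nedge => ane; exists a.
case: asboolP => [vE|vp]; last first.
  by split=> // -[a [va _]]; case: vp; rewrite va; congr tri_pt; apply/loop/loops.
split=> [l3|[a [va ->]]]; last by rewrite /tri_label loops //=.
by exists (Ordinal l3, Ordinal l3); rewrite vE loop // /tri_label eqxx.
Qed.

Lemma nb_closed_walks_tri (n : nat) (v : R * R) : tri_vertex v ->
  nb_closed_walks (@tri_loop_mult R) n v = sq_trinomial_sum n.
Proof.
move=> /tri_vertexP[p ->].
rewrite (nb_closed_walks_words tri_pt_inj tri_step_inj tri_loop_mult_step).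
exact: nb_words_tri_closed.
Qed.

End lattices.

(** * The cube of the Bessel function *)

Section complex_limits.
Variable R : realType.
Implicit Type z : R[i].

Lemma norm_complexP z (M : R) : `|z| <= M%:C ->
  `|complex.Re z| <= M /\ `|complex.Im z| <= M.
Proof.
rewrite normc_def lecR => h; split; apply: le_trans h.
  by rewrite -sqrtr_sqr ler_sqrt ?addr_ge0 ?sqr_ge0 // lerDl sqr_ge0.
by rewrite -sqrtr_sqr ler_sqrt ?addr_ge0 ?sqr_ge0 // lerDr sqr_ge0.
Qed.

Lemma norm_complex_le z : `|z| <= (`|complex.Re z| + `|complex.Im z|)%:C.
Proof.
rewrite normc_def lecR -[leRHS]ger0_norm ?addr_ge0 // -sqrtr_sqr.
rewrite ler_sqrt ?sqr_ge0 // sqrrD !real_normK ?num_real // addrAC lerDl.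
by rewrite mulrn_wge0 // mulr_ge0.
Qed.

Lemma cvg_complex (T : Type) (F : set_system T) (f : T -> R[i]^o) z :
  Filter F ->
  complex.Re (f x) @[x --> F] --> complex.Re z ->
  complex.Im (f x) @[x --> F] --> complex.Im z ->
  f @ F --> (z : R[i]^o).
Proof.
move=> FF /cvgrPdist_lt cRe /cvgrPdist_lt cIm; apply/cvgrPdist_lt => -[e e'].
(* A positive element of [R[i]] has imaginary part 0, so the radius is real. *)
rewrite ltcE /= => /andP[/eqP -> e0]; have e20 : 0 < e / 2 by rewrite divr_gt0.
apply: filterS2 (cRe _ e20) (cIm _ e20) => x hRe hIm.
apply: le_lt_trans (norm_complex_le _) _; rewrite ltcR [ltRHS](splitr e).
by rewrite !raddfB /= ltrD.
Qed.

Lemma series_le_cvg_norm (u v : nat -> R) :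
  (forall n, `|u n| <= v n) -> cvgn (series v) -> cvgn (series u).
Proof.
move=> uv cv; apply: normed_cvg; apply: series_le_cvg cv => n //=.
exact: le_trans (uv n).
Qed.

End complex_limits.

Section bessel.
Variable R : realType.

Definition inv_sq_fact (n : nat) : R := (n`!%:R ^+ 2)^-1.

(* Below degree [N], the coefficients of the cube of this polynomial are those of
   the Cauchy product of the full series. *)
Definition bessel_poly (N : nat) : {poly R} := \poly_(k < N) inv_sq_fact k.

Definition bessel3_coef (n : nat) : R := (sq_trinomial_sum n)%:R * inv_sq_fact n.

Lemma inv_sq_fact_ge0 (n : nat) : 0 <= inv_sq_fact n.
Proof. by rewrite invr_ge0 sqr_ge0. Qed.

Lemma bessel3_coef_ge0 (n : nat) : 0 <= bessel3_coef n.
Proof. by rewrite mulr_ge0 ?inv_sq_fact_ge0. Qed.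

Lemma inv_sq_fact_le (n : nat) : inv_sq_fact n <= n`!%:R^-1.
Proof.
rewrite lef_pV2 ?posrE ?exprn_gt0 ?ltr0n ?fact_gt0 //.
by rewrite expr2 ler_peMr // ler1n fact_gt0.
Qed.

Lemma inv_sq_factM (n i : nat) : (i <= n)%N ->
  inv_sq_fact i * inv_sq_fact (n - i) = 'C(n, i)%:R ^+ 2 * inv_sq_fact n.
Proof.
move=> i_n; rewrite /inv_sq_fact -(bin_fact i_n) !natrM.
have f0 k : k`!%:R != 0 :> R by rewrite pnatr_eq0 -lt0n fact_gt0.
have c0 : 'C(n, i)%:R != 0 :> R by rewrite pnatr_eq0 -lt0n bin_gt0.
by field; rewrite c0 !f0.
Qed.

Lemma coef_bessel_poly2 (N n : nat) : (n < N)%N ->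
  (bessel_poly N * bessel_poly N)`_n =
  (\sum_(i < n.+1) 'C(n, i) ^ 2)%N%:R * inv_sq_fact n.
Proof.
move=> nN; rewrite coefM natr_sum mulr_suml; apply: eq_bigr => i _.
rewrite !coef_poly (leq_ltn_trans _ nN) ?leq_ord //.
by rewrite (leq_ltn_trans (leq_subr _ _) nN) inv_sq_factM ?leq_ord // natrX.
Qed.

Lemma coef_bessel_poly3 (N n : nat) : (n < N)%N ->
  (bessel_poly N ^+ 3)`_n = bessel3_coef n.
Proof.
move=> nN; rewrite exprSr expr2 coefM /bessel3_coef natr_sum mulr_suml.
apply: eq_bigr => s _; have s_n : (s <= n)%N by exact: leq_ord.
rewrite coef_bessel_poly2 ?(leq_ltn_trans s_n) // coef_poly.
rewrite (leq_ltn_trans (leq_subr _ _) nN) natrM natrX.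
by rewrite -[LHS]mulrA inv_sq_factM // mulrCA mulrA.
Qed.

(** Coefficients being nonnegative, those of the cube grow with [N], and they equal [bessel3_coef n]
    once [N] exceeds [n]. *)
Lemma coef_bessel_poly3_bounds (N n : nat) :
  0 <= (bessel_poly N ^+ 3)`_n <= bessel3_coef n.
Proof.
have c0 M k : 0 <= (bessel_poly M)`_k.
  by rewrite coef_poly; case: ifP; rewrite ?inv_sq_fact_ge0.
have c0' M k : 0 <= (bessel_poly M * bessel_poly M)`_k.
  by rewrite coefM sumr_ge0 // => i _; rewrite mulr_ge0.
have cle k : (bessel_poly N)`_k <= (bessel_poly (N + n.+1))`_k.
  rewrite !coef_poly; case: ltnP => kN; last by case: ifP; rewrite ?inv_sq_fact_ge0.
  by rewrite (leq_trans kN (leq_addr _ _)).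
have n_lt : (n < N + n.+1)%N by rewrite addnS ltnS leq_addl.
rewrite -(coef_bessel_poly3 n_lt) !exprSr !expr0 !mul1r 2!(coefM (_ * _)).
apply/andP; split; first by apply: sumr_ge0 => i _; rewrite mulr_ge0.
apply: ler_sum => i _; rewrite ler_pM // !coefM.
by apply: ler_sum => j _; rewrite ler_pM.
Qed.

(** Bounding [a_n] by [9 ^ n] and dropping one factor [1 / n!] dominates the cubed series by that of
    [exp (9 x)]. *)
Lemma bessel3_coef_pow_le (x : R) (n : nat) :
  0 <= x -> bessel3_coef n * x ^+ n <= exp_coeff (9 * x) n.
Proof.
move=> x0; rewrite /exp_coeff /= exprMn [leRHS]mulrAC.
rewrite ler_pM ?bessel3_coef_ge0 ?exprn_ge0 //.
rewrite ler_pM ?inv_sq_fact_ge0 ?inv_sq_fact_le // -natrX ler_nat.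
exact: sq_trinomial_sum_le.
Qed.

Lemma is_cvg_bessel3_series (x : R) : 0 <= x ->
  cvgn (series (fun n => bessel3_coef n * x ^+ n)).
Proof.
move=> x0; apply: series_le_cvg_norm (is_cvg_series_exp_coeff (9 * x)) => n.
by rewrite ger0_norm ?bessel3_coef_pow_le // mulr_ge0 ?bessel3_coef_ge0 ?exprn_ge0.
Qed.


Definition bessel_sum (z : R[i]) (N : nat) : R[i] :=
  \sum_(0 <= k < N) (inv_sq_fact k)%:C * z ^+ k.

Definition bessel3_sum (z : R[i]) (N : nat) : R[i] :=
  \sum_(0 <= n < N) (bessel3_coef n)%:C * z ^+ n.

(** The cube of the partial sum is a polynomial in [z] of degree less than [3 N] whose coefficients
    below [N] are already final. *)
Lemma bessel_sum_cube (z : R[i]) (N : nat) :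
  bessel_sum z N ^+ 3 = bessel3_sum z N +
  \sum_(N <= n < N * 3) ((bessel_poly N ^+ 3)`_n)%:C * z ^+ n.
Proof.
have -> : bessel_sum z N = (map_poly (real_complex R) (bessel_poly N)).[z].
  rewrite (@horner_coef_wide _ N); last first.
    by rewrite size_map_poly; exact: size_poly.
  rewrite /bessel_sum big_mkord; apply: eq_bigr => k _.
  by rewrite coef_map coef_poly ltn_ord.
rewrite -horner_exp -rmorphXn /= (@horner_coef_wide _ (N * 3)); last first.
  (* For [N = 0] the general bound on the size of a power would give 1, while size 0 is required. *)
  rewrite size_map_poly; case: N => [|N]; last first.
    apply: leq_trans (size_poly_exp_leq _ _) _.
    apply: (@leq_ltn_trans (N * 3)); last by rewrite ltn_mul2r ltnSn.
    by rewrite leq_mul2r -subn1 leq_subLR add1n size_poly.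
  by rewrite /bessel_poly poly_def big_ord0 expr0n size_poly0.
rewrite -(big_mkord xpredT (fun n => (map_poly (real_complex R) _)`_n * z ^+ n)).
rewrite (@big_cat_nat _ _ _ N) //= ?leq_pmulr //.
congr (_ + _); last by apply: eq_bigr => n _; rewrite coef_map.
apply: eq_big_nat => n /andP[_ nN].
by rewrite coef_map /= coef_bessel_poly3.
Qed.

Lemma bessel3_sum_cube_dist (z : R[i]) (r : R) (N : nat) : `|z| = r%:C ->
  `|bessel_sum z N ^+ 3 - bessel3_sum z N| <=
  (\sum_(N <= n < N * 3) bessel3_coef n * r ^+ n)%:C.
Proof.
move=> zr; rewrite bessel_sum_cube addrAC subrr add0r rmorph_sum.
apply: le_trans (ler_norm_sum _ _ _) _; apply: ler_sum => n _.
rewrite normrM normrX zr rmorphM rmorphXn /=.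
have /andP[b0 b1] := coef_bessel_poly3_bounds N n.
rewrite ler_wpM2r ?exprn_ge0 -?zr // ger0_norm ?lecR //.
Qed.

Lemma norm_complexE (z : R[i]) : `|z| = (complex.Re `|z|)%:C.
Proof. by rewrite normc_def. Qed.

(** The series depends on [u] only through [(u / 2) ^ 2], which makes the choice of a square root
    irrelevant. *)
Lemma bessel_sumE (u z : R[i]) : (u / 2) ^+ 2 = z ->
  besselI0 u = limn (bessel_sum z : nat -> R[i]^o).
Proof.
move=> uz; rewrite /besselI0 [X in limn X](_ : _ = bessel_sum z) //.
apply/funext => N.
rewrite /series /bessel_sum /=; apply: eq_bigr => k _.
by rewrite exprM uz /inv_sq_fact fmorphV rmorphXn rmorph_nat.
Qed.

(** [besselI0] is defined by [limn], so convergence has to be established; both parts of the series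
    are dominated by that of [exp |z|]. *)
Lemma cvg_bessel_sum (u z : R[i]) : (u / 2) ^+ 2 = z ->
  complex.Re (bessel_sum z N) @[N --> \oo] --> complex.Re (besselI0 u) /\
  complex.Im (bessel_sum z N) @[N --> \oo] --> complex.Im (besselI0 u).
Proof.
move=> uz; pose r := complex.Re `|z|.
have zr : `|z| = r%:C := norm_complexE z.
have r0 : 0 <= r by have := normr_ge0 z; rewrite zr lecR.
have term n : `|complex.Re ((inv_sq_fact n)%:C * z ^+ n)| <= exp_coeff r n /\
              `|complex.Im ((inv_sq_fact n)%:C * z ^+ n)| <= exp_coeff r n.
  apply: norm_complexP; rewrite normrM normrX zr ger0_norm ?lecR ?inv_sq_fact_ge0 //.
  rewrite -rmorphXn -rmorphM lecR /exp_coeff /= mulrC.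
  by rewrite ler_wpM2l ?exprn_ge0 ?inv_sq_fact_le.
have cRe : cvgn (series (fun n => complex.Re ((inv_sq_fact n)%:C * z ^+ n))).
  apply: series_le_cvg_norm (is_cvg_series_exp_coeff r) => n.
  by have [] := term n.
have cIm : cvgn (series (fun n => complex.Im ((inv_sq_fact n)%:C * z ^+ n))).
  apply: series_le_cvg_norm (is_cvg_series_exp_coeff r) => n.
  by have [] := term n.
have eRe : (fun N => complex.Re (bessel_sum z N)) =
           series (fun n => complex.Re ((inv_sq_fact n)%:C * z ^+ n)).
  by apply/funext => N; rewrite /series /= raddf_sum.
have eIm : (fun N => complex.Im (bessel_sum z N)) =
           series (fun n => complex.Im ((inv_sq_fact n)%:C * z ^+ n)).
  by apply/funext => N; rewrite /series /= raddf_sum.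
rewrite eRe eIm (bessel_sumE uz).
pose l : R[i] := limn (series (fun n => complex.Re ((inv_sq_fact n)%:C * z ^+ n)))
  +i* limn (series (fun n => complex.Im ((inv_sq_fact n)%:C * z ^+ n))).
suff -> : limn (bessel_sum z : nat -> R[i]^o) = l by [].
apply: cvg_lim => //; apply: cvg_complex.
  by rewrite eRe.
by rewrite eIm.
Qed.

Lemma cvg_bessel3_sum (u z : R[i]) : (u / 2) ^+ 2 = z ->
  complex.Re (bessel3_sum z N) @[N --> \oo] --> complex.Re (besselI0 u ^+ 3) /\
  complex.Im (bessel3_sum z N) @[N --> \oo] --> complex.Im (besselI0 u ^+ 3).
Proof.
move=> uz; have [cRe cIm] := cvg_bessel_sum uz.
have ReX3 (w : R[i]) :
    complex.Re (w ^+ 3) = complex.Re w * complex.Re w * complex.Re w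
    - complex.Im w * complex.Im w * complex.Re w *+ 3.
  by case: w => a b; rewrite !exprS expr0 /=; ring.
have ImX3 (w : R[i]) :
    complex.Im (w ^+ 3) = complex.Re w * complex.Re w * complex.Im w *+ 3
    - complex.Im w * complex.Im w * complex.Im w.
  by case: w => a b; rewrite !exprS expr0 /=; ring.
pose r := complex.Re `|z|.
have zr : `|z| = r%:C := norm_complexE z.
have r0 : 0 <= r by have := normr_ge0 z; rewrite zr lecR.
(* A block between [N] and [3 N] of a convergent series tends to 0, so cubing the partial sums and
   truncating the cubed series give the same limit. *)
pose t (N : nat) := \sum_(N <= n < N * 3) bessel3_coef n * r ^+ n.
have t0 : t @ \oo --> 0.
  have c := is_cvg_bessel3_series r0.
  have -> : t = (fun N => series (fun n => bessel3_coef n * r ^+ n) (N * 3) -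
                          series (fun n => bessel3_coef n * r ^+ n) N).
    by apply/funext => N; rewrite sub_series_geq // leq_pmulr.
  rewrite -[0](subrr (limn (series (fun n => bessel3_coef n * r ^+ n)))).
  apply: cvgB; last exact: c.
  apply: (cvg_comp (fun N => (N * 3)%N) _ _ c).
  apply/cvgnyPge => A; exists A => // N /= AN.
  by rewrite (leq_trans AN) // leq_pmulr.
have tl N := norm_complexP (bessel3_sum_cube_dist N zr).
have sub (a b : nat -> R) (l : R) : a @ \oo --> l ->
    (forall N, `|a N - b N| <= t N) -> b @ \oo --> l.
  move=> al abt.
  have -> : b = a - (a - b) by rewrite opprB addrC subrK.
  rewrite -[l]subr0; apply: cvgB => //.
  apply/norm_cvg0P; apply: squeeze_cvgr (cvg_cst _) t0.
  by near=> N; rewrite normr_ge0 abt.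
split.
  apply: (sub (fun N => complex.Re (bessel_sum z N ^+ 3))); last first.
    by move=> N; have [+ _] := tl N; rewrite raddfB.
  under eq_fun do rewrite ReX3.
  rewrite ReX3; apply: cvgB; first by do 2 apply: cvgM => //.
  by apply: cvgMn; do 2 apply: cvgM => //.
apply: (sub (fun N => complex.Im (bessel_sum z N ^+ 3))); last first.
  by move=> N; have [_ +] := tl N; rewrite raddfB.
under eq_fun do rewrite ImX3.
rewrite ImX3; apply: cvgB; last by do 2 apply: cvgM => //.
by apply: cvgMn; do 2 apply: cvgM => //.
Unshelve. all: by end_near. Qed.

End bessel.

(** * Moments and termwise integration *)

Section termwise_integration.
Context d (T : measurableType d) (R : realType).
Variables (mu : {measure set T -> \bar R}) (D : set T).
Hypothesis mD : measurable D.

(** Dominated convergence for the partial sums. The dominating function is the sum [g] of the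
    absolute values, integrable because its integral is at most the sum of the [m n]. *)
Lemma Rintegral_series (f : nat -> T -> R) (m : nat -> R) (h : T -> R) :
  (forall n, measurable_fun D (f n)) ->
  (forall n, \int[mu]_(x in D) `|f n x|%:E <= (m n)%:E)%E ->
  cvgn (series m) ->
  (forall x, D x -> series (f ^~ x) @ \oo --> h x) ->
  mu.-integrable D (EFin \o h) /\
  series (fun n => \int[mu]_(x in D) f n x) @ \oo --> \int[mu]_(x in D) h x.
Proof.
move=> mf fm cm fh.
pose g x := (\sum_(n <oo) `|f n x|%:E)%E.
have mfE n : measurable_fun D (EFin \o f n) by exact/measurable_EFinP.
have mnf n : measurable_fun D (fun x => `|f n x|%:E).
  by apply/measurable_EFinP; apply: measurableT_comp => //; exact: mf.
have m0 n : 0 <= m n.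
  by rewrite -lee_fin (le_trans _ (fm n)) // integral_ge0 // => x _; rewrite lee_fin.
have mseries N : measurable_fun D (fun x => series (f ^~ x) N).
  by apply: measurable_sum => n; exact: mf.
have intg : mu.-integrable D g.
  apply/integrableP; split.
    rewrite (_ : g = fun x => (\sum_(n <oo | n \in xpredT) `|f n x|%:E)%E) //.
    by apply: ge0_emeasurable_sum => // n x _ _; rewrite lee_fin.
  rewrite (eq_integral g) => [|x _]; last first.
    by rewrite gee0_abs // nneseries_ge0 // => n _ _; rewrite lee_fin.
  rewrite integral_nneseries //.
  apply: (@le_lt_trans _ _ (\sum_(n <oo) (m n)%:E)%E).
    by apply: lee_nneseries => // n _ _; apply: integral_ge0 => x _; rewrite lee_fin.
  under eq_fun do rewrite sumEFin.
  by rewrite EFin_lim // ltry.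
have intf n : mu.-integrable D (EFin \o f n).
  apply/integrableP; split => //.
  exact: le_lt_trans (fm n) (ltry (m n)).
have [|||||ih _ c] := @dominated_convergence _ _ _ mu _ mD
    (fun N x => (series (f ^~ x) N)%:E) (EFin \o h) g.
- by move=> N; apply/measurable_EFinP.
- by apply/measurable_EFinP; apply: measurable_fun_cvg fh.
- by apply: aeW => x Dx; apply: cvg_EFin; [exact: nearW|exact: fh].
- exact: intg.
- apply: aeW => x N Dx /=.
  apply: (@le_trans _ _ (\sum_(0 <= n < N) `|f n x|%:E)%E).
    by rewrite sumEFin lee_fin; exact: ler_norm_sum.
  by apply: nneseries_lim_ge => n _ _; rewrite lee_fin.
split => //.
have -> : series (fun n => \int[mu]_(x in D) f n x) =
    fine \o (fun N => \int[mu]_(x in D) (series (f ^~ x) N)%:E)%E.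
  apply/funext => N /=.
  under eq_integral => x _ do rewrite -sumEFin.
  rewrite integral_sum // /series /= sum_fine // => n _.
  exact: (integrable_fin_num mD (intf n)).
apply: fine_cvg; rewrite fineK //; exact: (integrable_fin_num mD ih).
Qed.


(** The real and imaginary parts are integrated termwise; in each, the [n]-th term has absolute
    integral at most [|a n| * m n]. *)
Lemma cintegral_power_series (g : T -> R) (F : T -> R[i]) (a : nat -> R[i])
    (m : nat -> R) :
  measurable_fun D g ->
  (forall n, \int[mu]_(x in D) (`|g x| ^+ n)%:E <= (m n)%:E)%E ->
  cvgn (series (fun n => complex.Re `|a n| * m n)) ->
  (forall x, D x ->
    complex.Re (\sum_(0 <= n < N) a n * (g x)%:C ^+ n) @[N --> \oo]
      --> complex.Re (F x) /\
    complex.Im (\sum_(0 <= n < N) a n * (g x)%:C ^+ n) @[N --> \oo]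
      --> complex.Im (F x)) ->
  [/\ cintegrable mu D F,
    series (fun n => complex.Re (a n) * \int[mu]_(x in D) (g x ^+ n)) @ \oo
      --> complex.Re (cintegral mu D F) &
    series (fun n => complex.Im (a n) * \int[mu]_(x in D) (g x ^+ n)) @ \oo
      --> complex.Im (cintegral mu D F)].
Proof.
move=> mg gm cm gF.
have mgX n : measurable_fun D (fun x => g x ^+ n) by exact: measurable_funX.
have intX n : mu.-integrable D (EFin \o (fun x => g x ^+ n)).
  apply/integrableP; split; first exact/measurable_EFinP.
  apply: le_lt_trans (ltry (m n)); apply: le_trans (gm n).
  by under eq_integral do rewrite /= normrX.
have na n : `|a n| = (complex.Re `|a n|)%:C by rewrite normc_def.
have real_part (b : nat -> R) (h : T -> R) :
    (forall n, `|b n| <= complex.Re `|a n|) ->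
    (forall x, D x -> series (fun n => b n * g x ^+ n) @ \oo --> h x) ->
    mu.-integrable D (EFin \o h) /\
    series (fun n => b n * \int[mu]_(x in D) (g x ^+ n)) @ \oo
      --> \int[mu]_(x in D) h x.
  move=> ba bh.
  have [||||ih c] := Rintegral_series (f := fun n x => b n * g x ^+ n)
      (m := fun n => complex.Re `|a n| * m n) (h := h).
  - by move=> n; apply: measurable_funM => //; exact: measurable_cst.
  - move=> n; under eq_integral => x _ do rewrite normrM EFinM.
    rewrite ge0_integralZl //; last first.
      by apply/measurable_EFinP; apply: measurableT_comp => //; exact: mgX.
    rewrite EFinM; apply: lee_pmul => //; rewrite ?lee_fin //.
    + by apply: integral_ge0 => x _; rewrite lee_fin.
    + by under eq_integral => x _ do rewrite normrX; exact: gm.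
  - exact: cm.
  - exact: bh.
  split => //; rewrite (_ : (fun n => _) =
    (fun n => \int[mu]_(x in D) (b n * g x ^+ n))) //.
  by apply/funext => n; rewrite RintegralZl.
have ReM (r : R) z : complex.Re (z * r%:C) = complex.Re z * r.
  by case: z => x y /=; rewrite mulr0 subr0.
have ImM (r : R) z : complex.Im (z * r%:C) = complex.Im z * r.
  by case: z => x y /=; rewrite mulr0 add0r.
have [||iRe cRe] :=
  real_part (fun n => complex.Re (a n)) (fun x => complex.Re (F x)).
- move=> n; have [|] := norm_complexP (M := complex.Re `|a n|) (z := a n);
    by rewrite -?na.
- move=> x Dx; have [+ _] := gF x Dx; rewrite (_ : (fun N => _) =
    series (fun n => complex.Re (a n) * g x ^+ n)) //.
  apply/funext => N; rewrite raddf_sum /=; apply: eq_bigr => n _.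
  by rewrite -(rmorphXn (real_complex R)) ReM.
have [||iIm cIm] :=
  real_part (fun n => complex.Im (a n)) (fun x => complex.Im (F x)).
- move=> n; have [|] := norm_complexP (M := complex.Re `|a n|) (z := a n);
    by rewrite -?na.
- move=> x Dx; have [_ +] := gF x Dx; rewrite (_ : (fun N => _) =
    series (fun n => complex.Im (a n) * g x ^+ n)) //.
  apply/funext => N; rewrite raddf_sum /=; apply: eq_bigr => n _.
  by rewrite -(rmorphXn (real_complex R)) ImM.
by split.
Qed.

End termwise_integration.

(** * Moments of [t (1 - t)] and of [- ln t] on ]0, 1[ *)

Section moment_integrals.
Variable R : realType.
Local Notation mu := (@lebesgue_measure R).

(** The integral is the Beta function at [(n + 1, n + 1)]. *)
Lemma integral_beta_moment (n : nat) :
  (\int[mu]_(t in `]0%R, 1%R[) ((t * (1 - t)) ^+ n)%:E =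
   ((n`! * n`!)%:R / (n.*2.+1)`!%:R)%:E)%E.
Proof.
rewrite -addnn -beta_fun_fact EFin_beta_fun integral_XMonemX_restrict setTI.
rewrite -(@integral_itv_bndoo _ _ _ _ true false).
  by apply: eq_integral => x _; rewrite exprMn.
apply/measurable_EFinP; apply: measurable_funX.
by apply: measurable_funM => //; apply: measurable_funB.
Qed.

(* The recursion is the integration by parts of [(- ln x) ^+ n]. *)
Fixpoint neglog_primitive (n : nat) (x : R) : R :=
  if n is n'.+1 then x * (- ln x) ^+ n + n%:R * neglog_primitive n' x else x.

Lemma is_derive_neglog_primitive (n : nat) (x : R) : 0 < x ->
  is_derive x 1 (neglog_primitive n) ((- ln x) ^+ n).
Proof.
move=> x0; elim: n => [|n IH]; first by rewrite expr0; exact: is_derive_id.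
have dln := is_derive1_ln x0.
rewrite (_ : neglog_primitive n.+1 =
    id * (- @ln R) ^+ n.+1 + n.+1%:R *: neglog_primitive n); last first.
  by apply/funext => y; rewrite /= !fctE.
apply: is_derive_eq; rewrite /= ?exprfctE /GRing.scale /= mulr1.
change ((- @ln R) x) with (- ln x); rewrite exprS.
by field; rewrite gt_eqF.
Qed.

Lemma neglog_primitive1 (n : nat) : neglog_primitive n 1 = n`!%:R.
Proof.
elim: n => //= n ->; rewrite ln1 oppr0 expr0n mulr0 add0r.
by rewrite factS natrM.
Qed.

Lemma cvg_neglog_primitive (n : nat) :
  neglog_primitive n (expR (- k.+1%:R)) @[k --> \oo] --> (0 : R).
Proof.
(* From [exp x >= x ^ (m + 1) / (m + 1)!] at [x = k + 1]. *)
have bound m (k : nat) :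
    0 <= expR (- k.+1%:R) * k.+1%:R ^+ m <= m.+1`!%:R * (k.+1%:R : R)^-1.
  have k0 : 0 < k.+1%:R :> R by [].
  rewrite mulr_ge0 ?expR_ge0 ?exprn_ge0 //= expRN mulrC.
  rewrite ler_pdivrMr ?expR_gt0 // mulrAC ler_pdivlMr // -exprSr.
  rewrite mulrC -ler_pdivrMr ?ltr0n ?fact_gt0 //.
  by apply: le_trans (expR_ge1Dxn m (ltW k0)); rewrite lerDr.
have lim0 m : expR (- k.+1%:R) * k.+1%:R ^+ m @[k --> \oo] --> (0 : R).
  apply: (squeeze_cvgr _ (cvg_cst 0)).
    by near=> k; exact: bound.
  rewrite -[0](mulr0 m.+1`!%:R); apply: cvgM; first exact: cvg_cst.
  exact: cvg_harmonic.
elim: n => [|n IH] /=.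
  by have := lim0 0%N; under eq_fun do rewrite expr0 mulr1.
rewrite -[0]addr0 -[X in _ + X](mulr0 n.+1%:R); apply: cvgD.
  by under eq_fun do rewrite expRK opprK; exact: lim0.
by apply: cvgM => //; exact: cvg_cst.
Unshelve. all: by end_near. Qed.

(** The logarithm is singular at 0, so the fundamental theorem is applied on [[exp (- (k + 1)), 1]].
    These intervals increase to ]0, 1], and the primitive tends to 0 at their left ends. *)
Lemma integral_neglog_moment (n : nat) :
  (\int[mu]_(t in `]0%R, 1%R[) ((- ln t) ^+ n)%:E = n`!%:R%:E)%E.
Proof.
have cln (x : R) : 0 < x -> {for x, continuous (fun t : R => (- ln t) ^+ n)}.
  move=> x0; apply: (continuous_comp (f := fun t => - ln t) (g := fun y => y ^+ n)).
    by apply: continuousN; exact: continuous_ln.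
  exact: exprn_continuous.
have mln (D : set R) : measurable_fun D (fun t => ((- ln t) ^+ n)%:E).
  apply/measurable_EFinP; apply: measurable_funX.
  by apply: measurable_funN; apply: measurable_funTS; exact: measurable_ln.
pose F k := `[expR (- k.+1%:R), 1]%classic : set R.
have e_lt1 k : expR (- k.+1%:R) < 1 :> R by rewrite expR_lt1 oppr_lt0.
have FTC k : (\int[mu]_(t in F k) ((- ln t) ^+ n)%:E =
    (neglog_primitive n 1 - neglog_primitive n (expR (- k.+1%:R)))%:E)%E.
  have cF (x : R) : 0 < x -> {for x, continuous (neglog_primitive n)}.
    move=> x0; apply/differentiable_continuous/derivable1_diffP.
    by have [] := is_derive_neglog_primitive n x0.
  rewrite (continuous_FTC2 (F := neglog_primitive n)) ?EFinB //.
  - apply: continuous_in_subspaceT => x; rewrite inE /= in_itv /= => /andP[ex _].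
    by apply: cln; exact: lt_le_trans (expR_gt0 _) ex.
  - split=> [x||].
    + rewrite in_itv /= => /andP[ex _].
      by have [] := is_derive_neglog_primitive n (lt_trans (expR_gt0 _) ex).
    + by apply: cvg_at_right_filter; apply: cF; exact: expR_gt0.
    + by apply: cvg_at_left_filter; exact: cF.
  - move=> x; rewrite in_itv /= => /andP[ex _]; rewrite derive1E.
    by have [_ ->] := is_derive_neglog_primitive n (lt_trans (expR_gt0 _) ex).
have FU : \bigcup_k F k = `]0, 1]%classic.
  apply/seteqP; split=> x.
    move=> [k _]; rewrite /F /= !in_itv /= => /andP[ex ->].
    by rewrite (lt_le_trans (expR_gt0 _) ex).
  rewrite /= in_itv /= => /andP[x0 x1]; exists (Num.trunc (- ln x)) => //.
  rewrite /F /= in_itv /= x1 andbT -[leRHS]lnK ?posrE // ler_expR.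
  rewrite lerNl ltW //; apply: truncnS_gt.
have c : (\int[mu]_(t in F k) ((- ln t) ^+ n)%:E)%E @[k --> \oo] -->
    (\int[mu]_(t in `]0%R, 1%R]) ((- ln t) ^+ n)%:E)%E.
  rewrite -FU; apply: ge0_nondecreasing_set_cvg_integral => //.
  - move=> i j ij; apply/subsetPset => x; rewrite /F /= !in_itv /= => /andP[ex ->].
    by rewrite andbT (le_trans _ ex) // ler_expR lerN2 ler_nat.
  - by move=> k; exact: measurable_itv.
  - by move=> k; exact: (mln (F k)).
  - move=> k x; rewrite /F /= in_itv /= => /andP[ex x1].
    by rewrite lee_fin exprn_ge0 // oppr_ge0 ln_le0.
have c' : (\int[mu]_(t in F k) ((- ln t) ^+ n)%:E)%E @[k --> \oo] --> n`!%:R%:E.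
  under eq_fun do rewrite FTC.
  apply: cvg_EFin; first exact: nearW.
  rewrite -[n`!%:R]subr0 -neglog_primitive1; apply: cvgB; first exact: cvg_cst.
  exact: cvg_neglog_primitive.
rewrite integral_itv_bndo_bndc //.
exact: (cvg_unique (@ereal_hausdorff R) c c').
Qed.

End moment_integrals.

(** * Characteristic functions *)

Section imaginary_powers.
Variable R : realType.

(** The parts of ['i ^+ n] are written as in [cos_coeff] and [sin_coeff], to split the exponential
    series into those of cosine and sine. *)
Definition re_expi (n : nat) : R := (~~ odd n)%:R * (-1) ^+ n./2.

Definition im_expi (n : nat) : R := (odd n)%:R * (-1) ^+ n.-1./2.

Lemma expi (n : nat) : ('i : R[i]) ^+ n = re_expi n +i* im_expi n.
Proof.
rewrite -[in LHS](odd_double_half n) -mul2n exprD exprM sqr_i.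
have -> : (-1 : R[i]) ^+ n./2 = ((-1) ^+ n./2)%:C by rewrite rmorphXn rmorphN1.
rewrite /re_expi /im_expi; case: (boolP (odd n)) => on /=.
  have -> : n.-1./2 = n./2 by case: n on => //= n; rewrite uphalf_half => /negbTE ->.
  rewrite expr1; apply/eqP; rewrite eq_complex /=.
  by apply/andP; split; apply/eqP; ring.
rewrite expr0; apply/eqP; rewrite eq_complex /=.
by apply/andP; split; apply/eqP; ring.
Qed.

Lemma Re_expiM (n : nat) (r : R) : complex.Re ('i ^+ n * r%:C) = re_expi n * r.
Proof. by rewrite expi /= mulr0 subr0. Qed.

Lemma Im_expiM (n : nat) (r : R) : complex.Im ('i ^+ n * r%:C) = im_expi n * r.
Proof. by rewrite expi /= mulr0 add0r. Qed.

Lemma norm_expiM (n : nat) (r : R) : `|('i : R[i]) ^+ n * r%:C| = `|r|%:C.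
Proof.
rewrite normrM normrX (_ : `|'i| = 1) ?expr1n ?mul1r; last first.
  by rewrite normc_def /= expr0n /= expr1n add0r sqrtr1.
by rewrite normc_def /= expr0n /= addr0 sqrtr_sqr.
Qed.

Lemma norm_re_expi (n : nat) : `|re_expi n| <= 1.
Proof.
rewrite normrM normrX normrN1 expr1n mulr1.
by case: odd; rewrite ?normr0 ?normr1.
Qed.

Lemma cexp_i (x y : R) : cexp ('i * x%:C * y%:C) = cos (x * y) +i* sin (x * y).
Proof.
have -> : 'i * x%:C * y%:C = 0 +i* (x * y).
  by apply/eqP; rewrite eq_complex /=; apply/andP; split; apply/eqP; ring.
by rewrite /cexp /= expR0 mul1r.
Qed.

End imaginary_powers.

Section characteristic_function.
Context d (T : measurableType d) (R : realType) (P : probability T R).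
Variables (X : {RV P >-> R}) (K : set R) (mom : nat -> R).
Hypothesis compactK : compact K.
Hypothesis K1 : distribution P X (~` K) = 0%E.
Hypothesis momP : forall n, (\int[distribution P X]_x (x ^+ n)%:E = (mom n)%:E)%E.

Lemma abs_moment_bound : exists2 M : R, 0 <= M &
  forall n, (\int[P]_w (`|X w| ^+ n)%:E <= (M ^+ n)%:E)%E.
Proof.
have [M0 [_ KM]] := compact_bounded compactK.
(* Boundedness of [K] supplies a bound for every real above [M0], hence [M0 + 1]; the maximum with 0
   makes [M] nonnegative. *)
pose M := Num.max 0 (M0 + 1); exists M; first by rewrite le_max lexx.
have {}KM x : K x -> `|x| <= M.
  have M01 : M0 < M0 + 1 by rewrite ltrDl.
  move=> Kx; have xM : `|x| <= M0 + 1 := KM _ M01 x Kx.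
  by rewrite le_max xM orbT.
move=> n.
have mX : measurable_fun setT (fun x : R => (`|x| ^+ n)%:E).
  by apply/measurable_EFinP; apply: measurable_funX; exact: normr_measurable.
rewrite -[leLHS](ge0_integral_distribution X mX) => [|y]; last first.
  by rewrite lee_fin exprn_ge0.
apply: (@le_trans _ _ (\int[distribution P X]_x (M ^+ n)%:E)%E); last first.
  rewrite integral_cst //.
  by rewrite [X in (_ * X)%E](probability_setT (distribution P X)) mule1.
apply: ae_ge0_le_integral => //.
  by move=> x _; rewrite lee_fin exprn_ge0 // le_max lexx.
exists (~` K); split => //.
  by apply: measurableC; exact: compact_measurable.
move=> x /= /not_implyP[_]; apply: contra_not => Kx.
by rewrite lee_fin lerXn2r ?nnegrE ?KM // le_max lexx.
Qed.

(** The exponential series is integrated termwise: the bound [M ^ n] on the absolute moments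
    dominates it by the series of [exp (|s| M)]. *)
Lemma char_fun_series (s : R) :
  [/\ cintegrable P setT (fun w => cexp ('i * s%:C * (X w)%:C)),
    series (fun n => re_expi R n * (s ^+ n / n`!%:R) * mom n) @ \oo
      --> complex.Re (char_fun X s) &
    series (fun n => im_expi R n * (s ^+ n / n`!%:R) * mom n) @ \oo
      --> complex.Im (char_fun X s)].
Proof.
have [M M0 XM] := abs_moment_bound.
have momE n : \int[P]_w (X w ^+ n) = mom n.
  rewrite /Rintegral -[mom n]/(fine (mom n)%:E) -momP; congr fine.
  rewrite -(integral_distribution (f := fun x : R => (x ^+ n)%:E)) //.
    by apply/measurable_EFinP; exact: measurable_funX.
  apply/integrableP; split.
    by apply/measurable_EFinP; apply: measurable_funX.
  apply: le_lt_trans (ltry (M ^+ n)); apply: le_trans (XM n).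
  by under eq_integral do rewrite /= normrX.
have [||||iF cRe cIm] := @cintegral_power_series _ _ _ P setT measurableT X
  (fun w => cexp ('i * s%:C * (X w)%:C)) (fun n => 'i ^+ n * (s ^+ n / n`!%:R)%:C)
  (fun n => M ^+ n).
- by [].
- exact: XM.
- rewrite (_ : (fun n => _) = exp_coeff (`|s| * M)).
    exact: is_cvg_series_exp_coeff.
  apply/funext => n; rewrite norm_expiM /exp_coeff /= normrM normrX exprMn.
  by rewrite normfV normr_nat mulrAC.
- move=> w _; rewrite cexp_i /=.
  have E N : \sum_(0 <= n < N) ('i ^+ n * (s ^+ n / n`!%:R)%:C) * (X w)%:C ^+ n =
      \sum_(0 <= n < N) 'i ^+ n * ((s * X w) ^+ n / n`!%:R)%:C.
    apply: eq_bigr => n _; rewrite -mulrA -rmorphXn -rmorphM; congr (_ * _%:C).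
    by rewrite exprMn mulrAC.
  split.
    under eq_fun do rewrite E.
    have := @is_cvg_series_cos_coeff R (s * X w); rewrite cos.unlock.
    rewrite (_ : (fun N => _) = series (cos_coeff (s * X w))) //.
    apply/funext => N; rewrite raddf_sum /=; apply: eq_bigr => n _.
    by rewrite Re_expiM /cos_coeff /= mulrA.
  under eq_fun do rewrite E.
  have := @is_cvg_series_sin_coeff R (s * X w); rewrite sin.unlock.
  rewrite (_ : (fun N => _) = series (sin_coeff (s * X w))) //.
  apply/funext => N; rewrite raddf_sum /=; apply: eq_bigr => n _.
  by rewrite Im_expiM /sin_coeff /= mulrA.
split => //.
- move: cRe; rewrite (_ : (fun n => _) =
    (fun n => re_expi R n * (s ^+ n / n`!%:R) * mom n)) //.
  by apply/funext => n; rewrite Re_expiM momE.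
- move: cIm; rewrite (_ : (fun n => _) =
    (fun n => im_expi R n * (s ^+ n / n`!%:R) * mom n)) //.
  by apply/funext => n; rewrite Im_expiM momE.
Qed.

End characteristic_function.

(** * The integral for the triangular lattice with loops *)

Section triangular.
Variable R : realType.
Local Notation mu := (@lebesgue_measure R).

Lemma bessel3_coef_fact (n : nat) :
  bessel3_coef R n * n`!%:R = (sq_trinomial_sum n)%:R / n`!%:R.
Proof.
have f0 : n`!%:R != 0 :> R by rewrite pnatr_eq0 -lt0n fact_gt0.
by rewrite /bessel3_coef /inv_sq_fact; field.
Qed.

Lemma bessel3_coef_term (n : nat) (c x : R) :
  c * (bessel3_coef R n * x) * n`!%:R = c * (x / n`!%:R) * (sq_trinomial_sum n)%:R.
Proof.
rewrite -[LHS]mulrA [X in _ * X]mulrAC bessel3_coef_fact -[RHS]mulrA.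
by congr (_ * _); rewrite [LHS]mulrAC [RHS]mulrAC (mulrC x).
Qed.

(** The moment [n!] of [- ln t] cancels one factorial of [bessel3_coef], which leaves the series of
    [char_fun_series] with moments [a_n]. *)
Lemma tri_integrand_series (s : R) :
  [/\ cintegrable mu `]0, 1[ (tri_integrand s),
    series (fun n => re_expi R n * (s ^+ n / n`!%:R) * (sq_trinomial_sum n)%:R) @ \oo
      --> complex.Re (cintegral mu `]0, 1[ (tri_integrand s)) &
    series (fun n => im_expi R n * (s ^+ n / n`!%:R) * (sq_trinomial_sum n)%:R) @ \oo
      --> complex.Im (cintegral mu `]0, 1[ (tri_integrand s))].
Proof.
have momE n : \int[mu]_(t in `]0, 1[) ((- ln t) ^+ n) = n`!%:R.
  by rewrite /Rintegral integral_neglog_moment.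
have [||||iF cRe cIm] := @cintegral_power_series _ _ _ mu `]0, 1[%classic
  (measurable_itv _) (fun t => - ln t) (tri_integrand s)
  (fun n => 'i ^+ n * (bessel3_coef R n * s ^+ n)%:C) (fun n => n`!%:R).
- by apply: measurable_funN; apply: measurable_funTS; exact: measurable_ln.
- move=> n; rewrite -integral_neglog_moment le_eqVlt; apply/orP; left; apply/eqP.
  apply: eq_integral => t; rewrite inE /= in_itv /= => /andP[t0 t1].
  by rewrite ger0_norm // oppr_ge0 ln_le0 // ltW.
- apply: series_le_cvg_norm (is_cvg_series_exp_coeff (9 * `|s|)) => n.
  rewrite norm_expiM /= normrM normr_id normr_nat.
  rewrite normrM ger0_norm ?bessel3_coef_ge0 // mulrAC bessel3_coef_fact normrX.
  rewrite /exp_coeff /= exprMn mulrAC ler_wpM2r ?invr_ge0 //.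
  by rewrite ler_wpM2r ?exprn_ge0 // -natrX ler_nat sq_trinomial_sum_le.
- move=> t; rewrite /= in_itv /= => /andP[t0 t1].
  pose z := 'i * s%:C * (- ln t)%:C.
  (* Half the argument is ['i] times the square root, so squaring brings the sign that turns [ln t]
     into [- ln t]. *)
  have uz : (2 * 'i * sqrtC ('i * s%:C * (ln t)%:C) / 2) ^+ 2 = z.
    set q := sqrtC _; rewrite (_ : 2 * 'i * q / 2 = 'i * q); last by field.
    rewrite exprMn sqr_i sqrtCK mulN1r.
    by rewrite /z rmorphN mulrN.
  have [cRe cIm] := cvg_bessel3_sum uz.
  have E N :
      \sum_(0 <= n < N)
        ('i ^+ n * (bessel3_coef R n * s ^+ n)%:C) * (- ln t)%:C ^+ n =
      bessel3_sum z N.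
    apply: eq_bigr => n _; rewrite /z !exprMn rmorphM rmorphXn /=.
    by rewrite !mulrA; congr (_ * _ * _); rewrite mulrC.
  by split; under eq_fun do rewrite E.
split => //.
- move: cRe; rewrite (_ : (fun n => _) =
    (fun n => re_expi R n * (s ^+ n / n`!%:R) * (sq_trinomial_sum n)%:R)) //.
  by apply/funext => n; rewrite Re_expiM momE bessel3_coef_term.
- move: cIm; rewrite (_ : (fun n => _) =
    (fun n => im_expi R n * (s ^+ n / n`!%:R) * (sq_trinomial_sum n)%:R)) //.
  by apply/funext => n; rewrite Im_expiM momE bessel3_coef_term.
Qed.

End triangular.

(** * The integral for the hexagonal lattice and its derivative *)

Section hexagonal.
Variable R : realType.
Local Notation mu := (@lebesgue_measure R).

Definition hex_moment (n : nat) : nat :=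
  if odd n then 0%N else sq_trinomial_sum n./2.

Lemma hex_moment_le (n : nat) : (hex_moment n <= 9 ^ n)%N.
Proof.
rewrite /hex_moment; case: ifP => // _; apply: leq_trans (sq_trinomial_sum_le _) _.
by rewrite leq_exp2l // -divn2 leq_div.
Qed.

(** The odd moments vanish, so the characteristic function is real and [re_expi] accounts for all of
    it. *)
Definition hex_char_coef (n : nat) : R := re_expi R n * (hex_moment n)%:R / n`!%:R.

Definition hex_primitive_coef (n : nat) : R :=
  if n is n'.+1 then hex_char_coef n' / n%:R else 0.

Lemma hex_char_coef_le (n : nat) : `|hex_char_coef n| <= 9 ^+ n / n`!%:R.
Proof.
rewrite normrM normfV normr_nat ler_wpM2r ?invr_ge0 // normrM normr_nat.
rewrite -[leRHS]mul1r ler_pM ?norm_re_expi //.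
by rewrite -natrX ler_nat hex_moment_le.
Qed.

Lemma pseries_diffs_hex_primitive :
  pseries_diffs hex_primitive_coef = hex_char_coef.
Proof.
by apply/funext => n; rewrite /pseries_diffs /= mulrC mulfVK // pnatr_eq0.
Qed.

Lemma is_cvg_pseries_hex_char (x : R) : cvgn (pseries hex_char_coef x).
Proof.
apply: series_le_cvg_norm (is_cvg_series_exp_coeff (9 * `|x|)) => n.
rewrite normrM normrX /exp_coeff /= exprMn mulrAC ler_wpM2r ?exprn_ge0 //.
exact: hex_char_coef_le.
Qed.

Lemma is_cvg_pseries_hex_primitive (x : R) : cvgn (pseries hex_primitive_coef x).
Proof.
apply: series_le_cvg_norm (is_cvg_series_exp_coeff (9 * `|x|)) => n.
rewrite normrM normrX /exp_coeff /= exprMn mulrAC ler_wpM2r ?exprn_ge0 //.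
case: n => [|n] /=; first by rewrite normr0.
rewrite normrM normfV normr_nat.
apply: (@le_trans _ _ (9 ^+ n / n`!%:R / n.+1%:R)).
  by rewrite ler_wpM2r ?invr_ge0 // hex_char_coef_le.
rewrite factS natrM invfM mulrA mulrAC ler_wpM2r ?invr_ge0 // ler_wpM2r ?invr_ge0 //.
by rewrite exprS ler_peMl ?exprn_ge0 // ler1n.
Qed.

Lemma is_cvg_pseries_hex_char_diffs (x : R) :
  cvgn (pseries (pseries_diffs hex_char_coef) x).
Proof.
have c : cvgn (series (9 *: exp_coeff (9 * `|x|))).
  by apply: is_cvg_seriesZ; exact: is_cvg_series_exp_coeff.
apply: series_le_cvg_norm c => n.
rewrite normrM normrX /pseries_diffs normrM normr_nat.
apply: (@le_trans _ _ (n.+1%:R * (9 ^+ n.+1 / n.+1`!%:R) * `|x| ^+ n)).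
  by rewrite ler_wpM2r ?exprn_ge0 // ler_wpM2l // hex_char_coef_le.
rewrite /exp_coeff /GRing.scale /= le_eqVlt; apply/orP; left; apply/eqP.
rewrite /GRing.scale /= exprMn exprS factS natrM.
have f0 : n`!%:R != 0 :> R by rewrite pnatr_eq0 -lt0n fact_gt0.
by field; rewrite f0 /= nat1r pnatr_eq0.
Qed.

(** Termwise differentiation of a power series; the series and its first two formal derivatives
    converge at [|s| + 1], a point beyond [|s|]. *)
Lemma is_derive_hex_primitive (s : R) :
  is_derive s 1 (fun x => limn (pseries hex_primitive_coef x))
    (limn (pseries hex_char_coef s)).
Proof.
rewrite -pseries_diffs_hex_primitive; apply: (@pseries_snd_diffs _ _ (`|s| + 1)).
- exact: is_cvg_pseries_hex_primitive.
- by rewrite pseries_diffs_hex_primitive; exact: is_cvg_pseries_hex_char.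
- by rewrite pseries_diffs_hex_primitive; exact: is_cvg_pseries_hex_char_diffs.
- by rewrite ltr_normr ltrDl ltr01.
Qed.

(** The Beta moment cancels [n!^2] in [bessel3_coef]. The variable [(u / 2) ^ 2] is here the real
    number [- s ^ 2 t (1 - t)], hence the zero imaginary part. *)
Lemma hex_integrand_series (s : R) :
  [/\ cintegrable mu `]0, 1[ (hex_integrand s),
    series (fun n =>
      (-1) ^+ n * (sq_trinomial_sum n)%:R / (n.*2.+1)`!%:R * s ^+ n.*2) @ \oo
      --> complex.Re (cintegral mu `]0, 1[ (hex_integrand s)) &
    complex.Im (cintegral mu `]0, 1[ (hex_integrand s)) = 0].
Proof.
have b_fact n : bessel3_coef R n * (n`! * n`!)%:R = (sq_trinomial_sum n)%:R.
  have f0 : n`!%:R != 0 :> R by rewrite pnatr_eq0 -lt0n fact_gt0.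
  by rewrite natrM /bessel3_coef /inv_sq_fact; field.
have momE n : \int[mu]_(t in `]0, 1[) ((t * (1 - t)) ^+ n) =
    (n`! * n`!)%:R / (n.*2.+1)`!%:R.
  by rewrite /Rintegral integral_beta_moment.
(* The factor ['i ^+ 0] makes the lemmas on ['i ^+ n * r%:C] apply. *)
have [||||iF cRe cIm] := @cintegral_power_series _ _ _ mu `]0, 1[%classic
  (measurable_itv _) (fun t => t * (1 - t)) (hex_integrand s)
  (fun n => 'i ^+ 0 * (bessel3_coef R n * (- (s ^+ 2)) ^+ n)%:C)
  (fun n => (n`! * n`!)%:R / (n.*2.+1)`!%:R).
- by apply: measurable_funM => //; apply: measurable_funB.
- move=> n; rewrite -integral_beta_moment le_eqVlt; apply/orP; left; apply/eqP.
  apply: eq_integral => t; rewrite inE /= in_itv /= => /andP[t0 t1].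
  by rewrite ger0_norm // mulr_ge0 ?subr_ge0 // ltW.
- apply: series_le_cvg_norm (is_cvg_series_exp_coeff (9 * s ^+ 2)) => n.
  rewrite norm_expiM /= normrM normr_id (ger0_norm (x := _ / _)) ?divr_ge0 //.
  rewrite normrM ger0_norm ?bessel3_coef_ge0 // mulrAC mulrA b_fact.
  rewrite normrX normrN (ger0_norm (sqr_ge0 s)).
  rewrite /exp_coeff /= [in leRHS]exprMn [leRHS]mulrAC.
  rewrite ler_wpM2r ?(exprn_ge0 n (sqr_ge0 s)) //.
  apply: ler_pM => //.
    by rewrite -natrX ler_nat sq_trinomial_sum_le.
  rewrite lef_pV2 ?posrE ?ltr0n ?fact_gt0 // ler_nat leq_fact //.
  by rewrite -addnn leqW // leq_addr.
- move=> t; rewrite /= in_itv /= => /andP[t0 t1].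
  pose z := (- (s ^+ 2))%:C * (t * (1 - t))%:C.
  have uz : (2 * 'i * s%:C * (Num.sqrt (t * (1 - t)))%:C / 2) ^+ 2 = z.
    set q := Num.sqrt _; rewrite (_ : _ / 2 = 'i * s%:C * q%:C); last by field.
    rewrite !exprMn sqr_i -!rmorphXn sqr_sqrtr ?mulr_ge0 ?subr_ge0 // ?ltW //.
    by rewrite /z rmorphN /= mulN1r.
  have [cRe cIm] := cvg_bessel3_sum uz.
  have E N : \sum_(0 <= n < N)
      ('i ^+ 0 * (bessel3_coef R n * (- (s ^+ 2)) ^+ n)%:C) *
      (t * (1 - t))%:C ^+ n = bessel3_sum z N.
    apply: eq_bigr => n _; rewrite /z expr0 mul1r exprMn rmorphM.
    rewrite (rmorphXn (real_complex R)) /=.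
    by rewrite mulrA.
  by split; under eq_fun do rewrite E.
split => //.
- move: cRe; rewrite (_ : (fun n => _) = (fun n =>
    (-1) ^+ n * (sq_trinomial_sum n)%:R / (n.*2.+1)`!%:R * s ^+ n.*2)) //.
  apply/funext => n; rewrite Re_expiM momE -b_fact.
  have -> : (- (s ^+ 2)) ^+ n = (-1) ^+ n * s ^+ n.*2.
    by rewrite -mul2n exprM; exact: exprNn.
  by rewrite /re_expi /=; ring.
apply: (cvg_unique _ cIm); first exact: norm_hausdorff.
rewrite (_ : series _ = cst 0); first exact: cvg_cst.
apply/funext => N; apply: big1 => n _.
by rewrite Im_expiM /im_expi !mul0r.
Qed.

(** The primitive has odd degrees only, so its first [2 N] terms are [s] times the first [N] terms
    of the series of the integral. The limit is therefore taken along even indices. *)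
Lemma hex_primitiveE (s : R) :
  s%:C * cintegral mu `]0, 1[ (hex_integrand s) =
  (limn (pseries hex_primitive_coef s))%:C.
Proof.
have [_ cRe Im0] := hex_integrand_series s.
rewrite [cintegral _ _ _]complexE Im0 mulr0 addr0 -rmorphM /=; congr (_%:C).
have c : pseries hex_primitive_coef s @ \oo --> limn (pseries hex_primitive_coef s).
  exact: is_cvg_pseries_hex_primitive.
have c2 : pseries hex_primitive_coef s (N.*2) @[N --> \oo] -->
    limn (pseries hex_primitive_coef s).
  apply: (cvg_comp (fun N => N.*2) _ _ c).
  apply/cvgnyPge => A; exists A => // N /= AN.
  by rewrite (leq_trans AN) // -addnn leq_addr.
apply/esym; apply: (cvg_unique (@norm_hausdorff _ _) c2).
rewrite (_ : (fun N => _) = (fun N => s * series (fun n =>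
    (-1) ^+ n * (sq_trinomial_sum n)%:R / (n.*2.+1)`!%:R * s ^+ n.*2) N)).
  by apply: cvgM; [exact: cvg_cst|exact: cRe].
apply/funext; elim=> [|N IH]; first by rewrite /pseries /series /= !big_geq // mulr0.
rewrite /pseries /series /= !big_nat_recr //= in IH *.
rewrite mulrDr -IH -addrA; congr (_ + _).
have -> : hex_primitive_coef N.*2 = 0.
  case: N {IH} => //= N; rewrite /hex_char_coef /hex_moment /= odd_double /=.
  by rewrite mulr0 !mul0r.
rewrite mul0r add0r /hex_char_coef /hex_moment /re_expi odd_double doubleK /=.
rewrite mul1r factS natrM invfM exprS; ring.
Qed.

End hexagonal.

Lemma has_cderivative_real (R : realType) (g : R -> R) (s l : R) :
  is_derive s 1 g l -> has_cderivative (fun r => (g r)%:C) s l%:C.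
Proof.
move=> [dg gl].
have E h : (h%:C)^-1 * ((g (s + h))%:C - (g s)%:C) = (h^-1 * (g (s + h) - g s))%:C.
  by rewrite rmorphM rmorphB fmorphV.
rewrite /has_cderivative; under eq_fun do rewrite E.
apply: cvg_complex => /=; last exact: cvg_cst.
rewrite -gl (_ : (fun h => _) =
  (fun h : R => h^-1 *: ((g \o shift s) (h *: 1) - g s))); first exact: dg.
by apply/funext => h; rewrite /GRing.scale /= mulr1 (addrC h).
Qed.

Theorem proposition5 (R : realType)
    (dH dT : measure_display)
    (OmegaH : measurableType dH) (OmegaT : measurableType dT)
    (PH : probability OmegaH R) (PT : probability OmegaT R)
    (H : {RV PH >-> R}) (T : {RV PT >-> R})
    (vH vT : R * R)
    (vHin : hex_vertex vH) (vTin : tri_vertex vT)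
    (lawH : is_spectral_density (@hex_mult R) vH (distribution PH H))
    (lawT : is_spectral_density (@tri_loop_mult R) vT (distribution PT T)) :
  (forall s : R,
     cintegrable (@lebesgue_measure R) `]0, 1[ (hex_integrand s) /\
     has_cderivative
       (fun r : R =>
          r%:C * cintegral (@lebesgue_measure R) `]0, 1[ (hex_integrand r))
       s (char_fun H s)) /\
  (forall s : R,
     cintegrable (@lebesgue_measure R) `]0, 1[ (tri_integrand s) /\
     char_fun T s =
       cintegral (@lebesgue_measure R) `]0, 1[ (tri_integrand s)).
Proof.
have [[KH [compactKH KH1]] momH] := lawH.
have [[KT [compactKT KT1]] momT] := lawT.
have {}momH n :
    (\int[distribution PH H]_x (x ^+ n)%:E = (hex_moment n)%:R%:E)%E.
  by rewrite momH nb_closed_walks_hex.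
have {}momT n :
    (\int[distribution PT T]_x (x ^+ n)%:E = (sq_trinomial_sum n)%:R%:E)%E.
  by rewrite momT nb_closed_walks_tri.
have complex_eq (z w : R[i]) :
    complex.Re z = complex.Re w -> complex.Im z = complex.Im w -> z = w.
  by case: z w => a b [c d] /= -> ->.
split=> s; split.
- by have [] := hex_integrand_series s.
- have [_ cRe cIm] := char_fun_series compactKH KH1 momH s.
  have -> : char_fun H s = (limn (pseries (hex_char_coef R) s))%:C.
    apply: complex_eq => /=.
      apply/esym/cvg_lim => //; move: cRe.
      rewrite (_ : series _ = pseries (hex_char_coef R) s) //.
      apply/funext => N; apply: eq_bigr => n _.
      by rewrite /hex_char_coef /=; ring.
    (* Each term of the imaginary part vanishes: [im_expi] at even [n], the moment at odd [n]. *)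
    apply: (cvg_unique (@norm_hausdorff _ _) cIm).
    rewrite (_ : series _ = cst 0); first exact: cvg_cst.
    apply/funext => N; apply: big1 => n _.
    by rewrite /im_expi /hex_moment; case: odd; rewrite ?mul0r ?mulr0.
  rewrite (_ : (fun r => _) =
    (fun r => (limn (pseries (hex_primitive_coef R) r))%:C)).
    exact/has_cderivative_real/is_derive_hex_primitive.
  by apply/funext => r; exact: hex_primitiveE.
- by have [] := tri_integrand_series s.
have [_ cRe cIm] := char_fun_series compactKT KT1 momT s.
have [_ cRe' cIm'] := tri_integrand_series s.
(* Both sides are limits of the same two real series. *)
apply: complex_eq.
- exact: (cvg_unique (@norm_hausdorff _ _) cRe cRe').
- exact: (cvg_unique (@norm_hausdorff _ _) cIm cIm').
Qed.
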